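(* Let $G=\overline{\langle a_1,a_2,a_3\rangle}\subset W$ be the closed subgroup topologically generated by the elements $a_1,a_2,a_3\in W$ determined by $a_1=\sigma$, $a_2=(a_1,1)$, $a_3=(a_2,a_3)$, and let $N:=\operatorname{Norm}_W(G)$. Let $w_0\in W$ be the unique element with $w_0=(a_2w_0,a_3w_0)$, and define $w_1:=(1,(a_2a_3)^2)$ and $w_{i+1}:=(w_i,w_i)$ for all $i\ge1$. These elements lie in $N$ and converge to $1$. For $i\ge0$ and $k\in\mathbb{F}_2$ let $w_i^k$ denote $1$ if $k=0$ and $w_i$ if $k=1$, so that the map $$\varphi:\prod_{i=0}^\infty\mathbb{F}_2\to N,\qquad (k_0,k_1,k_2,\dots)\mapsto w_0^{k_0}w_1^{k_1}w_2^{k_2}\cdots$$ (limit of the finite products) is well-defined. Then $\varphi$ induces an isomorphism of groups $$\bar\varphi:\prod_{i=0}^\infty\mathbb{F}_2\ \xrightarrow{\ \sim\ }\ N/G.$$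
   Context: $T$ is the infinite rooted binary tree whose vertices are the finite words over $\{0,1\}$, with root the empty word, each word $t$ being joined by an edge to $t0$ and $t1$. $W:=\operatorname{Aut}(T)$ is its automorphism group, a profinite group as the inverse limit of the finite groups $W_n=\operatorname{Aut}(T_n)$, where $T_n\subset T$ is the subtree of words of length $\le n$. For $u,v\in W$, $(u,v)\in W$ denotes the automorphism $0t\mapsto 0\,u(t)$, $1t\mapsto 1\,v(t)$ for all words $t$; $\sigma\in W$ is the automorphism of order $2$ with $0t\mapsto 1t$ and $1t\mapsto 0t$. Thus $W=(W\times W)\rtimes\langle\sigma\rangle$. The recursion relations for $a_1,a_2,a_3$ and for $w_0$ have unique solutions in $W$. $\operatorname{Norm}_W(G)$ is the normalizer of $G$ in $W$. The map $\bar\varphi$ is the composite of $\varphi$ with the projection $N\to N/G$ ($\varphi$ itself is not a homomorphism). *)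

(* Defs.v *)
From HB Require Import structures.
From mathcomp Require Import all_boot all_algebra.
From mathcomp Require Import all_classical topology.

Set Implicit Arguments.
Unset Strict Implicit.
Unset Printing Implicit Defensive.

Import GRing.Theory.
Local Open Scope classical_set_scope.
Local Open Scope group_scope.

(* The letters 0 and 1 are false and true, and a word is read from the root:
   its children are obtained by appending a letter at the end (rcons), whereas
   the two copies of T below the root are obtained by prepending one (cons). *)
Definition word := seq bool.

Definition adj (s t : word) : bool :=
  [exists b : bool, (t == rcons s b) || (s == rcons t b)].

(* W = Aut(T), as rooted-tree automorphisms. *)
Record tree_aut := TreeAut {
  aut_fun :> word -> word;
  aut_bij : bijective aut_fun;
  aut_root : aut_fun [::] = [::];
  aut_adj : forall s t, adj (aut_fun s) (aut_fun t) = adj s t }.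

Lemma tree_autP (u v : tree_aut) : u =1 v -> u = v.
Proof.
case: u => f bf rf af; case: v => g bg rg ag /= /funext efg.
move: bg rg ag; rewrite -efg => bg rg ag.
by congr TreeAut; exact: Prop_irrelevance.
Qed.

Lemma adjC s t : adj s t = adj t s.
Proof. by apply: eq_existsb => b; rewrite orbC. Qed.

Lemma adjP s t :
  reflect ((exists b, t = rcons s b) \/ (exists b, s = rcons t b)) (adj s t).
Proof.
apply: (iffP existsP) => [[b /orP[/eqP|/eqP] h]|[[b ->]|[b ->]]].
- by left; exists b.
- by right; exists b.
- by exists b; rewrite eqxx.
- by exists b; rewrite eqxx orbT.
Qed.

Lemma adj0 b t : adj [::] (b :: t) = (t == [::]).
Proof.
apply/adjP/eqP => [[[c [_ ->]//]|[c]]|->].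
  by case: t => [|d t] /=.
by left; exists b.
Qed.

Lemma adj00 : adj [::] [::] = false.
Proof. by apply/adjP => -[[]|[]]. Qed.

Lemma adj_cons b c s t : adj (b :: s) (c :: t) = (b == c) && adj s t.
Proof.
apply/adjP/andP => [[[d [-> ->]]|[d [-> ->]]]|[/eqP-> /adjP[[d ->]|[d ->]]]].
- by split=> //; apply/adjP; left; exists d.
- by split=> //; apply/adjP; right; exists d.
- by left; exists d.
- by right; exists d.
Qed.

Lemma aut_inj (u : tree_aut) : injective u.
Proof. exact: bij_inj (aut_bij u). Qed.

Lemma aut_eq0 (u : tree_aut) t : (u t == [::]) = (t == [::]).
Proof. by rewrite -{1}(aut_root u) (inj_eq (@aut_inj u)). Qed.

Lemma size_aut (u : tree_aut) t : size (u t) = size t.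
Proof.
suff [] : size (u t) = size t /\ forall b, size (u (rcons t b)) = (size t).+1.
  by [].
have uadj s b : (exists c, u (rcons s b) = rcons (u s) c) \/
                (exists c, u s = rcons (u (rcons s b)) c).
  by apply/adjP; rewrite aut_adj; apply/adjP; left; exists b.
elim/last_ind: t => [|p d [IHp IHd]].
  rewrite aut_root; split=> // b.
  by case: (uadj [::] b) => -[c]; rewrite aut_root; [move=> ->|case: (u _)].
rewrite IHd size_rcons; split=> // b.
have [e ue] : exists e, u (rcons p d) = rcons (u p) e.
  case: (uadj p d) => [|[c /(congr1 size)]]; first by [].
  by rewrite size_rcons IHd IHp => /eqP; rewrite ltn_eqF.
case: (uadj (rcons p d) b) => -[c]; first by move=> ->; rewrite size_rcons IHd.
rewrite ue => /rcons_inj[/aut_inj /(congr1 size)] /eqP.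
by rewrite !size_rcons ltn_eqF.
Qed.

Definition aut_comp_subdef (u v : tree_aut) : tree_aut.
Proof.
exists (u \o v).
- exact: bij_comp (aut_bij u) (aut_bij v).
- by rewrite /= !aut_root.
- by move=> s t; rewrite /= !aut_adj.
Defined.

Definition aut_one : tree_aut.
Proof. by exists id => //; exists id. Defined.

Lemma aut_inv_exists (u : tree_aut) : exists g, cancel u g /\ cancel g u.
Proof. by case: (aut_bij u) => g gK Kg; exists g. Qed.

Definition aut_inv_fun (u : tree_aut) : word -> word :=
  sval (cid (aut_inv_exists u)).

Lemma aut_inv_funK (u : tree_aut) : cancel u (aut_inv_fun u).
Proof. by rewrite /aut_inv_fun; case: cid => g []. Qed.

Lemma aut_inv_funVK (u : tree_aut) : cancel (aut_inv_fun u) u.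
Proof. by rewrite /aut_inv_fun; case: cid => g []. Qed.

Definition aut_inv (u : tree_aut) : tree_aut.
Proof.
exists (aut_inv_fun u).
- by exists u; [exact: aut_inv_funVK|exact: aut_inv_funK].
- by apply: (@aut_inj u); rewrite aut_inv_funVK aut_root.
- by move=> s t; rewrite -(aut_adj u) !aut_inv_funVK.
Defined.

HB.instance Definition _ := gen_eqMixin tree_aut.
HB.instance Definition _ := gen_choiceMixin tree_aut.

(* W acts on T from the left: (u * v) t = u (v t). *)
Program Definition tree_aut_isGroup :=
  @isGroup.Build tree_aut aut_one aut_inv aut_comp_subdef _ _ _ _ _.
Next Obligation. by move=> u v w; exact: tree_autP. Qed.
Next Obligation. by move=> u; exact: tree_autP. Qed.
Next Obligation. by move=> u; exact: tree_autP. Qed.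
Next Obligation. by move=> u; apply: tree_autP => t /=; exact: aut_inv_funK. Qed.
Next Obligation. by move=> u; apply: tree_autP => t /=; exact: aut_inv_funVK. Qed.
HB.instance Definition _ := tree_aut_isGroup.
HB.instance Definition _ := isPointed.Build tree_aut (1 : tree_aut).

Lemma autM (u v : tree_aut) t : (u * v) t = u (v t). Proof. by []. Qed.
Lemma aut1 t : (1 : tree_aut) t = t. Proof. by []. Qed.

(* The fibre through u of the restriction W -> W_n. *)
Definition level_nbhd (n : nat) (u : tree_aut) : set tree_aut :=
  [set v | forall t, size t <= n -> v t = u t].

(* The inverse limit topology, for the discrete topology on each W_n. *)
Definition aut_nbhs (u : tree_aut) : set_system tree_aut :=
  [set A | exists n, level_nbhd n u `<=` A].
HB.instance Definition _ := hasNbhs.Build tree_aut aut_nbhs.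

Lemma level_nbhdW m n u : m <= n -> level_nbhd n u `<=` level_nbhd m u.
Proof. by move=> mn v uv t tm; apply: uv; exact: leq_trans mn. Qed.

Lemma aut_nbhs_filter (u : tree_aut) : ProperFilter (nbhs u).
Proof.
apply: Build_ProperFilter_ex.
  by move=> A [n uA]; exists u; exact: uA.
split.
- by exists 0%N.
- move=> A B [m mA] [n nB]; exists (maxn m n) => v uv; split.
    by apply/mA/level_nbhdW/uv; exact: leq_maxl.
  by apply/nB/level_nbhdW/uv; exact: leq_maxr.
- by move=> A B AB [n nA]; exists n => v /nA /AB.
Qed.

Lemma aut_nbhs_singleton (u : tree_aut) (A : set tree_aut) : nbhs u A -> A u.
Proof. by move=> [n]; apply. Qed.

Lemma aut_nbhs_nbhs (u : tree_aut) (A : set tree_aut) :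
  nbhs u A -> nbhs u (nbhs^~ A).
Proof.
move=> [n nA]; exists n => v uv; exists n => v' vv'; apply: nA => t tn.
by rewrite vv'// uv.
Qed.

HB.instance Definition _ := Nbhs_isNbhsTopological.Build tree_aut
  aut_nbhs_filter aut_nbhs_singleton aut_nbhs_nbhs.

Definition sigma_fun (t : word) : word := if t is b :: t' then ~~ b :: t' else [::].

Definition sigma : tree_aut.
Proof.
exists sigma_fun => //.
- by exists sigma_fun => -[//|b t] /=; rewrite negbK.
- move=> [|b s] [|c t] //=.
  + by rewrite !adj0.
  + by rewrite adjC [RHS]adjC !adj0.
  + by rewrite !adj_cons (inj_eq negb_inj).
Defined.

(* pair_aut u v is the automorphism (u, v) of the tree. *)
Definition pair_fun (u v : tree_aut) (t : word) : word :=
  match t with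
  | [::] => [::]
  | false :: t' => false :: u t'
  | true :: t' => true :: v t'
  end.

Definition pair_aut (u v : tree_aut) : tree_aut.
Proof.
exists (pair_fun u v) => //.
- exists (pair_fun u^-1 v^-1) => -[|[] t] //=;
    by rewrite ?(aut_inv_funK, aut_inv_funVK).
- move=> [|b s] [|c t] //.
  + by case: c => /=; rewrite !adj0 aut_eq0.
  + by case: b => /=; rewrite adjC [RHS]adjC !adj0 aut_eq0.
  + by case: b c => -[] /=; rewrite !adj_cons ?aut_adj.
Defined.

Definition is_subgroup (gT : groupType) (H : set gT) : Prop :=
  [/\ H 1, forall x y, H x -> H y -> H (x * y) & forall x, H x -> H x^-1].

Record subgroup (gT : groupType) := Subgroup {
  subgroup_set :> set gT;
  subgroupP : is_subgroup subgroup_set }.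

Definition left_coset (gT : groupType) (x : gT) (H : set gT) : set gT :=
  [set x * h | h in H].

(* Equality is required: for infinite groups x H x^-1 `<=` H is weaker. *)
Definition normalizer (gT : groupType) (H : set gT) : set gT :=
  [set x | [set x * h * x^-1 | h in H] = H].

(* N(G) / G: the cosets x G with x in N(G), with the elementwise operations. *)
Record quotient_group (gT : groupType) (G : subgroup gT) := Quotient {
  quotient_set :> set gT;
  quotient_lcoset : exists2 x, normalizer G x & quotient_set = left_coset x G }.

Section QuotientGroup.
Variables (gT : groupType) (G : subgroup gT).
Implicit Types (x y : gT) (A B C : quotient_group G).

Lemma quotient_inj A B : (A : set gT) = B -> A = B.
Proof.
case: A => A hA; case: B => B hB /= eAB.
by move: hB; rewrite -eAB => hB; congr Quotient; exact: Prop_irrelevance.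
Qed.

Let G1 : (G : set gT) 1. Proof. by case: (subgroupP G). Qed.
Let GM x y : (G : set gT) x -> (G : set gT) y -> (G : set gT) (x * y).
Proof. by case: (subgroupP G) => _ + _; apply. Qed.
Let GV x : (G : set gT) x -> (G : set gT) x^-1.
Proof. by case: (subgroupP G) => _ _; apply. Qed.

Lemma normalizerJ x h :
  normalizer G x -> (G : set gT) h -> (G : set gT) (x * h * x^-1).
Proof. by move=> {2}<- Gh; exists h. Qed.

Lemma normalizerJV x h :
  normalizer G x -> (G : set gT) h -> (G : set gT) (x^-1 * h * x).
Proof. by move=> nx; rewrite -{1}nx => -[g Gg <-]; rewrite !mulgA mulVg mul1g mulgVK. Qed.

Lemma normalizer1 : normalizer G 1.
Proof.
apply/seteqP; split=> [_ [h Gh <-]|h Gh]; first by rewrite invg1 mulg1 mul1g.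
by exists h => //; rewrite invg1 mulg1 mul1g.
Qed.

Lemma normalizerM x y : normalizer G x -> normalizer G y -> normalizer G (x * y).
Proof.
move=> nx ny; apply/seteqP; split=> [_ [h Gh <-]|h Gh].
  have := normalizerJ nx (normalizerJ ny Gh).
  by rewrite invgM !mulgA.
exists (y^-1 * (x^-1 * h * x) * y).
  exact/(normalizerJV ny)/normalizerJV.
by rewrite invgM !mulgA !mulgK mulgV mul1g.
Qed.

Lemma normalizerV x : normalizer G x -> normalizer G x^-1.
Proof.
move=> nx; apply/seteqP; split=> [_ [h Gh <-]|h Gh].
  by rewrite invgK; exact: normalizerJV.
exists (x * h * x^-1); first exact: normalizerJ.
by rewrite invgK !mulgA mulVg mul1g mulgVK.
Qed.

Lemma quotient_mul_subproof A B : exists2 z, normalizer G z &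
  [set a * b | a in (A : set gT) & b in (B : set gT)] = left_coset z G.
Proof.
case: (quotient_lcoset A) => x nx ->; case: (quotient_lcoset B) => y ny ->.
exists (x * y); first exact: normalizerM.
apply/seteqP; split=> [_ [_ [g Gg <-]] [_ [h Gh <-]] <-|_ [g Gg <-]].
  exists (y^-1 * g * y * h); first by apply: GM => //; exact: normalizerJV.
  by rewrite !mulgA mulgK.
exists x; first by exists 1 => //; rewrite mulg1.
by exists (y * g); [exists g|rewrite mulgA].
Qed.
Definition quotient_mul A B : quotient_group G := Quotient (quotient_mul_subproof A B).

Lemma quotient_inv_subproof A : exists2 z, normalizer G z &
  [set a^-1 | a in (A : set gT)] = left_coset z G.
Proof.
case: (quotient_lcoset A) => x nx ->; exists x^-1; first exact: normalizerV.
apply/seteqP; split=> [_ [_ [g Gg <-]] <-|_ [g Gg <-]].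
  exists (x * g^-1 * x^-1); first exact/(normalizerJ nx)/GV.
  by rewrite invgM !mulgA mulVg mul1g.
exists (x * (x^-1 * g^-1 * x)).
  by exists (x^-1 * g^-1 * x) => //; exact/(normalizerJV nx)/GV.
by rewrite !mulgA mulgV mul1g invgM invgK.
Qed.
Definition quotient_inv A : quotient_group G := Quotient (quotient_inv_subproof A).

Lemma quotient_one_subproof :
  exists2 z, normalizer G z & (G : set gT) = left_coset z G.
Proof.
exists 1; first exact: normalizer1.
apply/seteqP; split=> [h Gh|_ [h Gh <-]]; last by rewrite mul1g.
by exists h => //; rewrite mul1g.
Qed.
Definition quotient_one : quotient_group G := Quotient quotient_one_subproof.

Lemma quotient_mulA : associative quotient_mul.
Proof.
move=> A B C; apply/quotient_inj/seteqP; split=> /=.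
  move=> _ [a Aa] [_ [b Bb] [c Cc <-] <-].
  by exists (a * b); [exists a => //; exists b|exists c => //; rewrite mulgA].
move=> _ [_ [a Aa] [b Bb <-]] [c Cc <-].
by exists a => //; exists (b * c); [exists b => //; exists c|rewrite mulgA].
Qed.

Lemma quotient_mul1 : right_id quotient_one quotient_mul.
Proof.
move=> A; apply/quotient_inj/seteqP; split=> /=; last first.
  by move=> a Aa; exists a => //; exists 1 => //; rewrite mulg1.
case: (quotient_lcoset A) => x nx -> _ [_ [g Gg <-]] [h Gh <-].
by exists (g * h); [exact: GM|rewrite mulgA].
Qed.

Lemma quotient_1mul : left_id quotient_one quotient_mul.
Proof.
move=> A; apply/quotient_inj/seteqP; split=> /=; last first.
  by move=> a Aa; exists 1 => //; exists a => //; rewrite mul1g.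
case: (quotient_lcoset A) => x nx -> _ [g Gg] [_ [h Gh <-] <-].
exists (x^-1 * g * x * h); first by apply: GM => //; exact: normalizerJV.
by rewrite !mulgA mulgV mul1g.
Qed.

Lemma quotient_mulV : right_inverse quotient_one quotient_inv quotient_mul.
Proof.
move=> A; apply/quotient_inj; case: (quotient_lcoset A) => x nx /= eA.
apply/seteqP; split=> [_ [a + [_ [b + <-] <-]]|h Gh].
  rewrite eA => -[g Gg <-] [h Gh <-]; rewrite invgM !mulgA -(mulgA x).
  by apply: normalizerJ => //; apply: GM => //; exact: GV.
exists (x * (x^-1 * h * x)).
  by rewrite eA; exists (x^-1 * h * x) => //; exact: normalizerJV.
exists x^-1; first by exists x => //; rewrite eA; exists 1 => //; rewrite mulg1.
by rewrite !mulgA mulgV mul1g mulgK.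
Qed.

Lemma quotient_Vmul : left_inverse quotient_one quotient_inv quotient_mul.
Proof.
move=> A; apply/quotient_inj; case: (quotient_lcoset A) => x nx /= eA.
apply/seteqP; split=> [_ [_ [a + <-] [b + <-]]|h Gh].
  rewrite eA => -[g Gg <-] [h Gh <-]; rewrite invgM !mulgA mulgVK.
  by apply: GM => //; exact: GV.
exists x^-1; first by exists x => //; rewrite eA; exists 1 => //; rewrite mulg1.
by exists (x * h); [rewrite eA; exists h|rewrite mulgA mulVg mul1g].
Qed.

HB.instance Definition _ := gen_eqMixin (quotient_group G).
HB.instance Definition _ := gen_choiceMixin (quotient_group G).
HB.instance Definition _ := isGroup.Build (quotient_group G) quotient_mulA
  quotient_1mul quotient_mul1 quotient_Vmul quotient_mulV.

End QuotientGroup.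

Lemma closure_autP (A : set tree_aut) (u : tree_aut) :
  closure A u <-> forall n, exists2 v, A v & level_nbhd n u v.
Proof.
split=> [cA n|cA B [n nB]].
  by have [|v [Av uv]] := cA (level_nbhd n u); [exists n|exists v].
by have [v Av uv] := cA n; exists v; split=> //; exact: nB.
Qed.

Lemma closure_is_subgroup (H : set tree_aut) :
  is_subgroup H -> is_subgroup (closure H).
Proof.
move=> [H1 HM HV]; split.
- exact: subset_closure.
- move=> u v /closure_autP cu /closure_autP cv; apply/closure_autP => n.
  have [x Hx ux] := cu n; have [y Hy vy] := cv n.
  exists (x * y); first exact: HM.
  by move=> t tn; rewrite !autM vy// ux// size_aut.
- move=> u /closure_autP cu; apply/closure_autP => n.
  have [x Hx ux] := cu n; exists x^-1; first exact: HV.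
  move=> t tn; apply: (@aut_inj x); rewrite -autM mulgV aut1.
  by rewrite ux ?size_aut// -autM mulgV aut1.
Qed.

Lemma smallest_is_subgroup (gT : groupType) (S : set gT) :
  is_subgroup (smallest (@is_subgroup gT) S).
Proof.
split.
- by move=> H [[]].
- by move=> x y Sx Sy H SH; have [[_ HM _] _] := SH; apply: HM; [exact: Sx|exact: Sy].
- by move=> x Sx H SH; have [[_ _ HV] _] := SH; apply: HV; exact: Sx.
Qed.

Definition closed_subgroup (S : set tree_aut) : subgroup tree_aut :=
  Subgroup (closure_is_subgroup (smallest_is_subgroup S)).

(* Recursions u = (y0, y1) in W, where each y_b is either x b or x b * u (the
   latter when r b holds), have exactly one solution. *)
Section Recursion.
Variables (x : bool -> tree_aut) (r : bool -> bool).

Fixpoint rec_fun (t : word) : word :=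
  if t is b :: t' then b :: x b (if r b then rec_fun t' else t') else [::].

Lemma size_rec t : size (rec_fun t) = size t.
Proof.
by elim: t => //= b t IHt; rewrite size_aut; case: (r b); rewrite ?IHt.
Qed.

Lemma rec_fun_inj : injective rec_fun.
Proof.
elim=> [|b s IHs] [|c t] //= [<-] /aut_inj.
by case: (r b) => [/IHs ->|->].
Qed.

Lemma rec_fun_surj t : exists s, rec_fun s = t.
Proof.
move: {2}(size t) (erefl (size t)) => n; elim: n t => [|n IHn] [|b t] //=.
  by exists [::].
move=> [tn]; have : size ((x b)^-1 t) = n by rewrite size_aut.
case/IHn => s es; exists (b :: if r b then s else (x b)^-1 t) => /=.
by case: (r b); rewrite ?es aut_inv_funVK.
Qed.

Lemma rec_fun_bij : bijective rec_fun.
Proof.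
exists (fun t => sval (cid (rec_fun_surj t))) => t; last by case: cid.
by apply: rec_fun_inj; case: cid.
Qed.

Lemma rec_fun_adj s t : adj (rec_fun s) (rec_fun t) = adj s t.
Proof.
have nil b t' : (x b (if r b then rec_fun t' else t') == [::]) = (t' == [::]).
  by rewrite aut_eq0; case: (r b) => //; rewrite -!size_eq0 size_rec.
elim: s t => [|b s IHs] [|c t] //=.
- by rewrite !adj0 nil.
- by rewrite adjC [RHS]adjC !adj0 nil.
- rewrite !adj_cons; case: eqVneq => //= <-; rewrite aut_adj.
  by case: (r b).
Qed.

Definition rec_aut : tree_aut := TreeAut rec_fun_bij erefl rec_fun_adj.

Lemma rec_aut_unique : exists! u, u =
  pair_aut (if r false then x false * u else x false)
           (if r true then x true * u else x true).
Proof.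
exists rec_aut; split.
  by apply: tree_autP => -[|[] t] //=; [case: (r true)|case: (r false)].
move=> u eu; apply: tree_autP; elim=> [|b t IHt]; first by rewrite eu.
rewrite eu /=; case: b => /=; congr cons.
  by case: (r true) => //; rewrite autM -IHt.
by case: (r false) => //; rewrite autM -IHt.
Qed.

End Recursion.

Lemma a3_unique (a2 : tree_aut) : exists! a3, a3 = pair_aut a2 a3.
Proof.
have [u [eu uu]] := rec_aut_unique (fun b => if b then 1 else a2) id.
rewrite /= mul1g in eu; exists u; split=> // v ev.
by apply: uu; rewrite /= mul1g.
Qed.

Lemma w0_unique (a2 a3 : tree_aut) :
  exists! w0, w0 = pair_aut (a2 * w0) (a3 * w0).
Proof. exact: rec_aut_unique (fun b => if b then a3 else a2) xpredT. Qed.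

Definition phi_prod (w : nat -> tree_aut) (k : nat -> 'F_2) (n : nat) : tree_aut :=
  \prod_(i < n) (if k i == 0%R then 1 else w i).

(* Main.v *)
(* Write a, b, c for a1, a2, a3 and sgn_n for the signs of the actions on the
   levels of the tree.  Modulo the normal closure A of a, the group G becomes
   the dihedral group D = <b, c> of order 8, whose centre is generated by
   z = (bc)^2; let tau be the automorphism of D that exchanges b and c.  An
   element (u, v) lies in G iff u and v do and the images of u and v in D
   correspond under tau.  The image of g in D is explicit: two coordinates are
   signs, and the third one is a cocycle kappa that depends only on the action
   on four levels.  This makes G a set defined by a recursive boolean condition.

   The normalizer N acts on D by inner automorphisms, so every coset of G in N
   contains elements acting trivially on D; these form the subgroup N0.  If
   (u, v) normalizes G and u is in N0, then v is in N0 and u v^-1 is in G with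
   central image in D.  Hence every x in N is w1^k (u, u) g with k in {0, 1},
   u in N0 and g in G.  Iterating this shows that x^2 is in G for all x in N0,
   and yields the exponents k_i for i >= 1.  The exponent k_0 is the value of
   sgn_2 + sgn_3 on N0, which vanishes on the intersection of G and N0 and on
   all w_i with i >= 1, whereas it is 1 on w_0 = c (w_0, w_0). *)
Require Import Defs.
From mathcomp Require Import all_boot all_algebra.
From mathcomp Require Import all_classical topology.

Set Implicit Arguments.
Unset Strict Implicit.
Unset Printing Implicit Defensive.

Local Open Scope classical_set_scope.
Local Open Scope group_scope.

Implicit Types (g h u v x y : tree_aut).

(** * Sections and signs *)

Definition flips (g : tree_aut) : bool := head false (g [:: false]).

Lemma aut_rcons (g : tree_aut) s b : exists c, g (rcons s b) = rcons (g s) c.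
Proof.
have /adjP[//|[c gs]] : adj (g s) (g (rcons s b)).
  by rewrite aut_adj; apply/adjP; left; exists b.
by move: (congr1 size gs) => /eqP; rewrite size_rcons !size_aut size_rcons ltn_eqF.
Qed.

Lemma aut_letter (g : tree_aut) b : g [:: b] = [:: b (+) flips g].
Proof.
have g1 c : exists d, g [:: c] = [:: d].
  by have [d] := aut_rcons g [::] c; rewrite aut_root; exists d.
rewrite /flips; case: (g1 false) => c0 e0; case: (g1 true) => c1 e1.
rewrite e0; case: b; rewrite ?e0 ?e1 //=.
have: [:: c1] != [:: c0] by rewrite -e1 -e0 (inj_eq (@aut_inj g)).
by case: c0 c1 {e0 e1} => -[].
Qed.

Lemma aut_cons (g : tree_aut) b t :
  g (b :: t) = (b (+) flips g) :: behead (g (b :: t)).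
Proof.
suff [s ->] : exists s, g (b :: t) = (b (+) flips g) :: s by [].
elim/last_ind: t => [|t c [s IHt]]; first by exists [::]; exact: aut_letter.
have [d] := aut_rcons g (b :: t) c; rewrite IHt rcons_cons => ->.
by exists (rcons s d).
Qed.

Lemma section_adj (g : tree_aut) b s t :
  adj (behead (g (b :: s))) (behead (g (b :: t))) = adj s t.
Proof.
have := aut_adj g (b :: s) (b :: t).
by rewrite (aut_cons g b s) (aut_cons g b t) !adj_cons !eqxx.
Qed.

Lemma section_root (g : tree_aut) b : behead (g [:: b]) = [::].
Proof. by rewrite aut_letter. Qed.

Lemma section_bij (g : tree_aut) b : bijective (fun t => behead (g (b :: t))).
Proof.
have fV : flips g^-1 = flips g.
  have := aut1 [:: false]; rewrite -(mulVg g) autM !aut_letter => -[].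
  by case: (flips g); case: (flips _).
exists (fun t => behead (g^-1 (b (+) flips g :: t))) => t.
  by rewrite -aut_cons -autM mulVg aut1.
have -> : b :: behead (g^-1 (b (+) flips g :: t)) = g^-1 (b (+) flips g :: t).
  by rewrite [in RHS]aut_cons fV -addbA addbb addbF.
by rewrite -autM mulgV aut1.
Qed.

Definition sec (g : tree_aut) (b : bool) : tree_aut :=
  TreeAut (section_bij g b) (section_root g b) (section_adj g b).

Lemma secE g b t : g (b :: t) = (b (+) flips g) :: sec g b t.
Proof. exact: aut_cons. Qed.

Lemma sec_ext g h : flips g = flips h -> sec g =1 sec h -> g = h.
Proof.
move=> fgh sgh; apply: tree_autP => -[|b t]; first by rewrite !aut_root.
by rewrite !secE fgh sgh.
Qed.

Lemma flipsM g h : flips (g * h) = flips g (+) flips h.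
Proof.
have := aut_letter (g * h) false; rewrite autM !aut_letter => -[/=].
by rewrite addbC => ->.
Qed.

Lemma secM g h b : sec (g * h) b = sec g (b (+) flips h) * sec h b.
Proof.
apply: tree_autP => t; rewrite autM.
by have := secE (g * h) b t; rewrite autM !secE => /(congr1 behead).
Qed.

Lemma flips1 : flips 1 = false. Proof. by []. Qed.

Lemma sec1 b : sec 1 b = 1. Proof. exact: tree_autP. Qed.

Lemma flipsV g : flips g^-1 = flips g.
Proof.
by have := flips1; rewrite -(mulVg g) flipsM; case: (flips g); case: (flips _).
Qed.

Lemma secV g b : sec g^-1 b = (sec g (b (+) flips g))^-1.
Proof.
apply: (mulgI (sec g (b (+) flips g))).
by rewrite mulgV -{1}(flipsV g) -secM mulgV sec1.
Qed.

Lemma flips_sigma : flips sigma = true. Proof. by []. Qed.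
Lemma sec_sigma b : sec sigma b = 1.
Proof. by apply: tree_autP => t; case: b. Qed.
Lemma flips_pair u v : flips (pair_aut u v) = false. Proof. by []. Qed.
Lemma sec_pair u v b : sec (pair_aut u v) b = if b then v else u.
Proof. by apply: tree_autP => t; case: b. Qed.

Definition flipsE := (flipsM, flipsV, flips1, flips_sigma, flips_pair).
Definition sectE := (secM, secV, sec1, sec_sigma, sec_pair, flipsE).

Lemma pair_sec g : ~~ flips g -> pair_aut (sec g false) (sec g true) = g.
Proof. by move=> /negbTE fg; apply: sec_ext => [|[]]; rewrite ?fg ?sec_pair. Qed.

Lemma pairM u v u' v' :
  pair_aut u v * pair_aut u' v' = pair_aut (u * u') (v * v').
Proof. by apply: sec_ext => [|[]]; rewrite !sectE. Qed.

Lemma pair1 : pair_aut 1 1 = 1.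
Proof. by apply: sec_ext => [|[]]; rewrite !sectE. Qed.

Lemma pairV u v : (pair_aut u v)^-1 = pair_aut u^-1 v^-1.
Proof. by apply: sec_ext => [|[]]; rewrite !sectE. Qed.

Lemma sigma_pair u v : sigma * pair_aut u v * sigma = pair_aut v u.
Proof. by apply: sec_ext => [|[]]; rewrite !sectE ?mulg1 ?mul1g. Qed.

Lemma sigmaK : sigma * sigma = 1.
Proof. by apply: sec_ext => [|[]]; rewrite !sectE ?mulg1. Qed.

(* [sgn n g] is the sign of the permutation of the words of length n + 1. *)
Fixpoint sgn (n : nat) (g : tree_aut) : bool :=
  if n is m.+1 then sgn m (sec g false) (+) sgn m (sec g true) else flips g.

Arguments sgn : simpl never.

Lemma sgnS n g : sgn n.+1 g = sgn n (sec g false) (+) sgn n (sec g true).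
Proof. by []. Qed.

Lemma sgn0 g : sgn 0 g = flips g. Proof. by []. Qed.

Lemma sgnM n g h : sgn n (g * h) = sgn n g (+) sgn n h.
Proof.
elim: n g h => [|n IHn] g h; first exact: flipsM.
rewrite !sgnS !secM !IHn /=; case: (flips h) => /=; last by rewrite addbACA.
by rewrite addbACA (addbC (sgn n (sec g true))).
Qed.

Lemma sgn1 n : sgn n 1 = false.
Proof. by elim: n => // n IHn; rewrite sgnS !sec1 IHn. Qed.

Lemma sgnV n g : sgn n g^-1 = sgn n g.
Proof.
by have := sgn1 n; rewrite -(mulVg g) sgnM; case: (sgn n g); case: (sgn _ _).
Qed.

Lemma sgn_sigma n : sgn n.+1 sigma = false.
Proof. by rewrite sgnS !sec_sigma !sgn1. Qed.

Lemma sgn_pair n u v : sgn n.+1 (pair_aut u v) = sgn n u (+) sgn n v.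
Proof. by rewrite sgnS !sec_pair. Qed.

Lemma sgnJ n g h : sgn n (g * h * g^-1) = sgn n h.
Proof. by rewrite !sgnM sgnV addbAC addbb. Qed.

(** * A recursive description of the closed group *)

Definition chi g : bool := sgn 0 g (+) sgn 1 g.

(* For [g] in the closed group, the exponent of [z] in the normal form
   [b^i c^j z^k] of the image of [g] in the dihedral group; the formula was
   found by following that exponent through products of [a], [b] and [c]. *)
Definition kappa g : bool :=
  chi (sec (sec g false) false) (+) chi (sec (sec g true) false).

Definition linked u v : bool :=
  [&& sgn 1 v == sgn 2 u, sgn 2 v == sgn 1 u &
      kappa v == kappa u (+) (sgn 1 u && sgn 2 u)].

(* [linked u v] says that the images of [u] and [v] in the dihedral group
   correspond under the automorphism exchanging [b] and [c]; the base case of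
   [Gn] is the part of [linked] that makes [kappa] a cocycle. *)
Fixpoint Gn (n : nat) (g : tree_aut) : bool :=
  if n is m.+1 then
    [&& Gn m (sec g false), Gn m (sec g true) & linked (sec g false) (sec g true)]
  else (sgn 1 (sec g true) == sgn 2 (sec g false)) &&
       (sgn 2 (sec g true) == sgn 1 (sec g false)).

Lemma GnS n g : Gn n.+1 g =
  [&& Gn n (sec g false), Gn n (sec g true) & linked (sec g false) (sec g true)].
Proof. by []. Qed.

Definition inG g : Prop := forall n, Gn n g.

Ltac case_bits :=
  repeat match goal with
  | |- context [sgn ?n ?g] => case: (sgn n g)
  | |- context [chi ?g] => case: (chi g)
  | |- context [kappa ?g] => case: (kappa g)
  end; by [].

Lemma chiM g h : chi (g * h) = chi g (+) chi h.
Proof. by rewrite /chi !sgnM addbACA. Qed.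

Lemma chi1 : chi 1 = false. Proof. by rewrite /chi !sgn1. Qed.

Lemma chiV g : chi g^-1 = chi g.
Proof. by rewrite /chi !sgnV. Qed.

(** The two sections have [chi] values adding up to [sgn 1 g (+) sgn 2 g], so one value determines
    the other. *)
Lemma chi_sec g b :
  chi (sec g b) = chi (sec g false) (+) (b && (sgn 1 g (+) sgn 2 g)).
Proof.
case: b; rewrite ?addbF //= /chi !sgnS.
by case_bits.
Qed.

Lemma GnW n g : Gn n g -> Gn 0 g.
Proof. by case: n => // n /= /and3P[_ _ /and3P[-> ->]]. Qed.

Lemma Gn0_sgn g b : Gn 0 g ->
  sgn 1 (sec g b) (+) sgn 2 (sec g b) = sgn 2 g.
Proof.
move=> /andP[/eqP e1 /eqP e2]; rewrite (sgnS 1 g) e1.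
by case: b; rewrite ?e1 ?e2 // addbC.
Qed.

(** Each flip of a section of [h] replaces a section of [g] by its sibling, which by [chi_sec] and
    [Gn0_sgn] costs [sgn 2 g]. The parity of the number of these flips is [sgn 1 h]. *)
Lemma kappaM g h : Gn 0 g ->
  kappa (g * h) = kappa g (+) kappa h (+) (sgn 2 g && sgn 1 h).
Proof.
move=> Lg; rewrite /kappa !secM !chiM.
rewrite (chi_sec (sec g _) (_ (+) _)).
rewrite (chi_sec (sec g (true (+) _)) (_ (+) _)) !Gn0_sgn //.
rewrite (sgnS 0 h) /=.
rewrite !sgn0; case: (flips h); case: (flips (sec h false));
  case: (flips (sec h true)); case_bits.
Qed.

Lemma kappa1 : kappa 1 = false.
Proof. by rewrite /kappa !sec1 chi1. Qed.

Lemma kappaV g : Gn 0 g -> kappa g^-1 = kappa g (+) (sgn 2 g && sgn 1 g).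
Proof.
move=> Lg; have := @kappaM g g^-1 Lg; rewrite mulgV kappa1 sgnV.
by case_bits.
Qed.

Lemma linkedC u v : linked u v = linked v u.
Proof.
by rewrite /linked; case_bits.
Qed.

Lemma linkedM u v u' v' : Gn 0 u -> Gn 0 v ->
  linked u v -> linked u' v' -> linked (u * u') (v * v').
Proof.
move=> Lu Lv /and3P[/eqP e1 /eqP e2 /eqP e3] /and3P[/eqP f1 /eqP f2 /eqP f3].
rewrite /linked !kappaM // !sgnM e1 e2 e3 f1 f2 f3 !eqxx /=.
by case_bits.
Qed.

Lemma linked1 : linked 1 1.
Proof. by rewrite /linked !sgn1 kappa1. Qed.

Lemma linkedV u v : Gn 0 u -> Gn 0 v -> linked u v -> linked u^-1 v^-1.
Proof.
move=> Lu Lv /and3P[/eqP e1 /eqP e2 /eqP e3].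
rewrite /linked !kappaV // !sgnV e1 e2 e3 !eqxx /=.
by case: (kappa u); case: (sgn 1 u); case: (sgn 2 u).
Qed.

Lemma GnM n g h : Gn n g -> Gn n h -> Gn n (g * h).
Proof.
elim: n g h => [|n IHn] g h.
  move=> /andP[/eqP e1 /eqP e2] /andP[/eqP f1 /eqP f2].
  rewrite /Gn !secM !sgnM f1 f2; case: (flips h) => /=; rewrite e1 e2 !eqxx //.
move=> /and3P[g0 g1 gl] /and3P[h0 h1 hl]; rewrite /= !secM.
have [Lg0 Lg1] := (GnW g0, GnW g1).
by case: (flips h); rewrite /= !IHn //= linkedM // linkedC.
Qed.

Lemma Gn1 n : Gn n 1.
Proof. by elim: n => [|n IHn] /=; rewrite !sec1 ?linked1 ?IHn ?sgn1. Qed.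

Lemma GnV n g : Gn n g -> Gn n g^-1.
Proof.
elim: n g => [|n IHn] g.
  move=> /andP[/eqP e1 /eqP e2].
  by rewrite /Gn !secV !sgnV; case: (flips g) => /=; rewrite e1 e2 !eqxx.
move=> /and3P[g0 g1 gl]; rewrite /= !secV.
have [Lg0 Lg1] := (GnW g0, GnW g1).
by case: (flips g); rewrite /= !IHn //= linkedV // linkedC.
Qed.

Lemma GnMr n g h : Gn n h -> Gn n (g * h) = Gn n g.
Proof.
move=> Gh; apply/idP/idP => [|Gg]; last exact: GnM.
by move=> /GnM/(_ (GnV Gh)); rewrite mulgK.
Qed.

Lemma GnMl n g h : Gn n h -> Gn n (h * g) = Gn n g.
Proof.
move=> Gh; apply/idP/idP => [|Gg]; last exact: GnM.
by move=> /(GnM (GnV Gh)); rewrite mulKg.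
Qed.

Lemma inG1 : inG 1. Proof. by move=> n; exact: Gn1. Qed.
Lemma inGM g h : inG g -> inG h -> inG (g * h).
Proof. by move=> Gg Gh n; exact: GnM. Qed.
Lemma inGV g : inG g -> inG g^-1.
Proof. by move=> Gg n; exact: GnV. Qed.

Lemma inG_sec g b : inG g -> inG (sec g b).
Proof. by move=> Gg n; have /and3P[G0 G1 _] := Gg n.+1; case: b. Qed.

Lemma inG_linked g : inG g -> linked (sec g false) (sec g true).
Proof. by move=> /(_ 1%N) /and3P[]. Qed.

Lemma inG_pairE u v : inG (pair_aut u v) <-> [/\ inG u, inG v & linked u v].
Proof.
split=> [Guv|[Gu Gv luv] n].
  have := inG_sec false Guv; have := inG_sec true Guv; have := inG_linked Guv.
  by rewrite !sec_pair.
case: n => [|n] /=; rewrite !sec_pair; last by rewrite Gu Gv.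
by case/and3P: luv => -> ->.
Qed.

Lemma inG_sigma : inG sigma.
Proof.
by case=> [|n] /=; rewrite !sec_sigma ?Gn1 ?linked1 //= !sec1 !flips1.
Qed.

(** * The generators a, b, c and the dihedral group of order 8 *)

Definition gena := sigma.
Definition genb := pair_aut gena 1.
Definition genc := rec_aut (fun b => if b then 1 else genb) id.

Lemma gencE : genc = pair_aut genb genc.
Proof. by apply: tree_autP => -[|[] t]. Qed.

Lemma sec_genb b : sec genb b = if b then 1 else gena. Proof. exact: sec_pair. Qed.
Lemma sec_genc b : sec genc b = if b then genc else genb.
Proof. by rewrite {1}gencE sec_pair. Qed.
Lemma flips_genc : flips genc = false. Proof. by rewrite gencE. Qed.

Lemma sgn_gena n : sgn n gena = (n == 0%N).
Proof. by case: n => // n; exact: sgn_sigma. Qed.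

Lemma sgn_genb n : sgn n genb = (n == 1%N).
Proof. by case: n => // n; rewrite sgn_pair sgn_gena sgn1 addbF. Qed.

Lemma sgn_genc n : sgn n genc = (2 <= n).
Proof.
elim: n => [|n IHn]; first by rewrite sgn0 flips_genc.
by rewrite gencE sgn_pair IHn sgn_genb; case: n {IHn} => [|[|n]].
Qed.

Lemma kappa_gena : kappa gena = false.
Proof. by rewrite /kappa !sec_sigma !sec1 chi1. Qed.

Lemma kappa_genb : kappa genb = false.
Proof. by rewrite /kappa !sec_genb sec_sigma !sec1 chi1. Qed.

Lemma kappa_genc : kappa genc = false.
Proof. by rewrite /kappa !sec_genc sec_genb /chi !sgn_gena !sgn_genb. Qed.

Lemma inG_gena : inG gena. Proof. exact: inG_sigma. Qed.

Lemma inG_genb : inG genb.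
Proof.
apply/inG_pairE; split; [exact: inG_gena|exact: inG1|].
by rewrite /linked !sgn_gena !sgn1 kappa1 kappa_gena.
Qed.

Lemma linked_genbc : linked genb genc.
Proof. by rewrite /linked !sgn_genb !sgn_genc kappa_genb kappa_genc. Qed.

Lemma inG_genc : inG genc.
Proof.
elim=> [|n IHn]; first by rewrite /= !sec_genc !sgn_genb !sgn_genc.
by rewrite GnS !sec_genc linked_genbc inG_genb IHn.
Qed.

Lemma gena2 : gena * gena = 1. Proof. exact: sigmaK. Qed.
Lemma genb2 : genb * genb = 1. Proof. by rewrite pairM gena2 mulg1 pair1. Qed.
Lemma genc2 : genc * genc = 1.
Proof.
apply: tree_autP; elim=> [|b t IHt]; first by rewrite aut_root.
rewrite gencE pairM genb2; case: b => //=.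
by congr cons; exact: IHt.
Qed.

Definition genz := pair_aut (pair_aut gena gena) 1.

Lemma genzE : (genb * genc) ^+ 2 = genz.
Proof.
rewrite gencE pairM mul1g expg2 pairM genc2 /genz; congr pair_aut.
by apply: sec_ext => [|[]]; rewrite !sectE ?mulg1 ?mul1g.
Qed.

Lemma genz2 : genz * genz = 1.
Proof. by rewrite !pairM gena2 mulg1 !pair1. Qed.

Lemma genzb : genz * genb = genb * genz.
Proof.
rewrite !pairM mul1g; congr pair_aut.
by apply: sec_ext => [|[]]; rewrite !sectE ?mulg1 ?mul1g.
Qed.

Lemma genzc : genz * genc = genc * genz.
Proof.
have aab : pair_aut gena gena * genb = genb * pair_aut gena gena.
  by rewrite !pairM mulg1 mul1g.
by rewrite gencE pairM (pairM genb) aab mul1g mulg1.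
Qed.

Lemma gencb : genc * genb = genb * (genc * genz).
Proof.
rewrite -genzc -genzE expg2 -!mulgA genc2 mulg1.
by rewrite (mulgA genb genb) genb2 mul1g.
Qed.

(* [<b, c>] is dihedral of order 8, with centre generated by [z = (bc)^2];
   [(sgn 1, sgn 2, kappa)] are the coordinates of an element of the group
   modulo the normal closure of [a] in the normal form [b^i c^j z^k]. *)
Definition rep (d : bool * bool * bool) : tree_aut :=
  (if d.1.1 then genb else 1) * (if d.1.2 then genc else 1) *
  (if d.2 then genz else 1).

Definition dih g : bool * bool * bool := (sgn 1 g, sgn 2 g, kappa g).

(** The last term comes from [c b = b c z]: moving [c] past [b] costs one central factor [z]. *)
Definition dmul (d e : bool * bool * bool) : bool * bool * bool :=
  (d.1.1 (+) e.1.1, d.1.2 (+) e.1.2, d.2 (+) e.2 (+) (d.1.2 && e.1.1)).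

Lemma repM d e : rep d * rep e = rep (dmul d e).
Proof.
case: d e => -[i j] k [[i' j'] k']; rewrite /rep /dmul /=.
move: genb genc genz genb2 genc2 genz2 genzb genzc gencb => b c z bb cc zz zb zc cb.
have bK x : b * (b * x) = x by rewrite mulgA bb mul1g.
have cK x : c * (c * x) = x by rewrite mulgA cc mul1g.
have zK x : z * (z * x) = x by rewrite mulgA zz mul1g.
have zbA x : z * (b * x) = b * (z * x) by rewrite mulgA zb mulgA.
have zcA x : z * (c * x) = c * (z * x) by rewrite mulgA zc mulgA.
have cbA x : c * (b * x) = b * (c * (z * x)) by rewrite mulgA cb -!mulgA.
by case: i; case: j; case: k; case: i'; case: j'; case: k' => /=;
  rewrite ?mulg1 ?mul1g -?mulgA
    ?(bb, cc, zz, zb, zc, cb, bK, cK, zK, zbA, zcA, cbA, mulg1, mul1g).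
Qed.

Lemma rep1 : rep (false, false, false) = 1.
Proof. by rewrite /rep !mulg1. Qed.

Lemma repV d : (rep d)^-1 = rep (d.1.1, d.1.2, d.2 (+) (d.1.2 && d.1.1)).
Proof.
apply/mulg1_eq; rewrite repM -rep1; congr rep.
by case: d => -[[] []] [].
Qed.

Lemma rep_subgroup : is_subgroup (range rep).
Proof.
split; first by exists (false, false, false) => //; exact: rep1.
  by move=> _ _ [d _ <-] [e _ <-]; rewrite repM; exists (dmul d e).
by move=> _ [d _ <-]; rewrite repV; eexists.
Qed.

Lemma dihM g h : Gn 0 g -> dih (g * h) = dmul (dih g) (dih h).
Proof. by move=> Lg; rewrite /dih /dmul /= !sgnM kappaM. Qed.

Lemma dih1 : dih 1 = (false, false, false).
Proof. by rewrite /dih !sgn1 kappa1. Qed.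

Lemma inG_genz : inG genz.
Proof.
by rewrite -genzE expg2; do !apply: inGM; exact: inG_genb || exact: inG_genc.
Qed.

Lemma kappa_genz : kappa genz = true.
Proof. by rewrite /kappa !sec_pair sec1 chi1 /chi !sgn_gena. Qed.

Lemma sgn_genz n : sgn n genz = false.
Proof. by case: n => // -[|n]; rewrite !sgn_pair ?sgn1 ?addbb. Qed.

Lemma inG_rep d : inG (rep d).
Proof.
have [Gb Gc Gz] := And3 inG_genb inG_genc inG_genz.
by rewrite /rep; do !apply: inGM; case: ifP => // _; exact: inG1.
Qed.

Lemma dih_rep d : dih (rep d) = d.
Proof.
have [Gb Gc] := (inG_genb 0%N, inG_genc 0%N).
have Gbc : Gn 0 ((if d.1.1 then genb else 1) * (if d.1.2 then genc else 1)).
  by apply: GnM; case: ifP => // _; exact: Gn1.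
rewrite /rep dihM // dihM; last by case: ifP => // _; exact: Gn1.
case: d {Gbc} => -[i j] k /=; rewrite /dih /dmul /=.
case: i; case: j; case: k;
  by rewrite !(sgn_genb, sgn_genc, sgn_genz, sgn1,
    kappa_genb, kappa_genc, kappa_genz, kappa1).
Qed.

Lemma dih_repV u d : inG u -> dih u = d -> dih ((rep d)^-1 * u) = (false, false, false).
Proof.
move=> Gu pu; rewrite repV dihM ?dih_rep ?pu; last exact: inG_rep.
by case: d {pu} => -[[] []] [].
Qed.

Lemma dih_div u v : inG u -> inG v -> dih u = dih v ->
  dih (u^-1 * v) = (false, false, false).
Proof.
move=> Gu Gv puv; rewrite dihM ?puv; last exact: inGV.
by rewrite -puv /dih !sgnV kappaV //; case: (sgn 1 u) (sgn 2 u) (kappa u) => -[] [].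
Qed.

Lemma linked_dih u v : linked u v ->
  (dih u == (false, false, false)) = (dih v == (false, false, false)).
Proof.
by rewrite /linked /dih !xpair_eqE !eqbF_neg; case_bits.
Qed.

(** * Restriction to finite levels *)

Lemma level_refl n g : level_nbhd n g g. Proof. by []. Qed.

Lemma level_sym n g h : level_nbhd n g h -> level_nbhd n h g.
Proof. by move=> gh t tn; rewrite gh. Qed.

Lemma level_trans n g h x :
  level_nbhd n g h -> level_nbhd n h x -> level_nbhd n g x.
Proof. by move=> gh hx t tn; rewrite hx// gh. Qed.

Lemma levelM n g h x y :
  level_nbhd n g x -> level_nbhd n h y -> level_nbhd n (g * h) (x * y).
Proof. by move=> gx hy t tn; rewrite !autM hy// gx// size_aut. Qed.

Lemma levelV n g h : level_nbhd n g h -> level_nbhd n g^-1 h^-1.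
Proof.
move=> gh t tn; apply: (@aut_inj h); rewrite -autM mulgV aut1.
by rewrite gh ?size_aut // -autM mulgV aut1.
Qed.

Lemma level0 g h : level_nbhd 0 g h.
Proof. by move=> t; rewrite leqn0 size_eq0 => /eqP ->; rewrite !aut_root. Qed.

Lemma levelSP n g h : level_nbhd n.+1 g h <->
  flips g = flips h /\ forall b, level_nbhd n (sec g b) (sec h b).
Proof.
split=> [gh|[fgh sgh] [|b t] tn]; last 2 first.
- by rewrite !aut_root.
- by rewrite !secE fgh sgh.
have fgh : flips g = flips h by rewrite /flips gh.
split=> // b t tn.
by have := gh (b :: t) tn; rewrite !secE => /(congr1 behead).
Qed.

Lemma level_pair n u v u' v' : level_nbhd n u u' -> level_nbhd n v v' ->
  level_nbhd n.+1 (pair_aut u v) (pair_aut u' v').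
Proof. by move=> uu' vv'; apply/levelSP; split=> // b; rewrite !sec_pair; case: b. Qed.

Lemma level_sgn n m g h : m < n -> level_nbhd n g h -> sgn m g = sgn m h.
Proof.
elim: n m g h => // n IHn [|m] g h mn /levelSP[fgh sgh] //.
by rewrite !sgnS !(IHn _ _ _ mn (sgh _)).
Qed.

(** [kappa] evaluates [sgn 1], which reads words of length 2, on sections two letters deep. *)
Lemma level_kappa n g h : 4 <= n -> level_nbhd n g h -> kappa g = kappa h.
Proof.
move=> n4 /(level_nbhdW n4) /levelSP[_ gh]; rewrite /kappa /chi.
have gh2 b c : level_nbhd 2 (sec (sec g b) c) (sec (sec h b) c).
  by have /levelSP[] := gh b.
by congr (_ (+) _ (+) (_ (+) _)); apply: level_sgn (gh2 _ _).
Qed.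

(** This makes [inG] a closed set: each unfolding of [Gn] descends by one letter, and [linked] reads
    only four levels of the sections. *)
Lemma level_Gn n m g h : n + 5 <= m -> level_nbhd m g h -> Gn n g = Gn n h.
Proof.
elim: n m g h => [|n IHn] [|m] g h // nm /levelSP[_ gh].
  have e k b : k < 4 -> sgn k (sec g b) = sgn k (sec h b).
    by move=> k4; apply: level_sgn (gh _); exact: leq_trans k4 (nm : 4 <= m).
  by rewrite /Gn !e.
have m4 : 4 <= m by apply: leq_trans (nm : n + 5 <= m); exact: leq_trans (leq_addl n 5).
rewrite !GnS !(IHn m _ _ _ (gh _)) // /linked.
rewrite !(level_kappa m4 (gh _)).
have e k b : k < 4 -> sgn k (sec g b) = sgn k (sec h b).
  by move=> k4; apply: level_sgn (gh _); exact: leq_trans k4 m4.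
by rewrite !e.
Qed.

(** * Density of the group generated by a, b and c *)

Definition gamma : set tree_aut :=
  smallest (@is_subgroup tree_aut) [set gena; genb; genc].

Lemma gamma_subgroup : is_subgroup gamma.
Proof. exact: smallest_is_subgroup. Qed.

Lemma gammaM g h : gamma g -> gamma h -> gamma (g * h).
Proof. by have [_ M _] := gamma_subgroup; exact: M. Qed.

Lemma gammaV g : gamma g -> gamma g^-1.
Proof. by have [_ _ V] := gamma_subgroup; exact: V. Qed.

Lemma gamma1 : gamma 1. Proof. by have [] := gamma_subgroup. Qed.

Lemma gamma_gena : gamma gena. Proof. by move=> H [_]; apply; left; left. Qed.
Lemma gamma_genb : gamma genb. Proof. by move=> H [_]; apply; left; right. Qed.
Lemma gamma_genc : gamma genc. Proof. by move=> H [_]; apply; right. Qed.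

Lemma gamma_ind (H : set tree_aut) : is_subgroup H ->
  H gena -> H genb -> H genc -> gamma `<=` H.
Proof. by move=> sH Ha Hb Hc g; apply; split=> // x [[->|->]|->]. Qed.

Lemma gamma_inG : gamma `<=` inG.
Proof.
apply: gamma_ind; [split|exact: inG_gena|exact: inG_genb|exact: inG_genc].
- exact: inG1.
- exact: inGM.
- exact: inGV.
Qed.

Lemma gamma_rep d : gamma (rep d).
Proof.
have Gz : gamma genz.
  by rewrite -genzE expg2; do !apply: gammaM; exact: gamma_genb || exact: gamma_genc.
have [Gb Gc] := (gamma_genb, gamma_genc).
by rewrite /rep; do !apply: gammaM; case: ifP => // _; exact: gamma1.
Qed.

Lemma gamma_swap u v : gamma (pair_aut u v) -> gamma (pair_aut v u).
Proof.
by move=> Guv; rewrite -sigma_pair; do 2?apply: gammaM; exact: gamma_gena || exact: Guv.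
Qed.

(* The second sections of the elements of the stabilizer of the first level
   are obtained from [a^b = (1, a)], [c^a = (c, b)] and [c = (b, c)], so the
   first section can be chosen in [<b, c>]. *)
Lemma gamma_lift h : gamma h -> exists d, gamma (pair_aut (rep d) h).
Proof.
have [D1 DM DV] := rep_subgroup.
suff: gamma `<=` [set h | exists2 x, range rep x & gamma (pair_aut x h)].
  by move=> /[apply] -[_ [d _ <-]]; exists d.
apply: gamma_ind; [split|exists 1|exists genc|exists genb].
- by exists 1 => //; rewrite pair1; exact: gamma1.
- move=> g g' [x Dx Gx] [x' Dx' Gx']; exists (x * x'); first exact: DM.
  by rewrite -pairM; exact: gammaM.
- by move=> g [x Dx Gx]; exists x^-1; [exact: DV|rewrite -pairV; exact: gammaV].
- exact: D1.
- by apply: gamma_swap; exact: gamma_genb.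
- by exists (false, true, false) => //; rewrite /rep /= mulg1 mul1g.
- by apply: gamma_swap; rewrite -gencE; exact: gamma_genc.
- by exists (true, false, false) => //; rewrite /rep /= !mulg1.
- by rewrite -gencE; exact: gamma_genc.
Qed.

(** A lift of [h] has its other section in [<b, c>] and linked to [h]. That section then has trivial
    dihedral image, so it is 1. *)
Lemma gamma_pair1 h : gamma h -> dih h = (false, false, false) ->
  gamma (pair_aut h 1).
Proof.
move=> Gh ph; have [d Gdh] := gamma_lift Gh.
have /inG_pairE[_ _ /linked_dih] := gamma_inG Gdh.
by rewrite ph eqxx dih_rep => /eqP d0; apply: gamma_swap; rewrite -rep1 -d0.
Qed.

Lemma level1P g : ~~ flips g -> level_nbhd 1 1 g.
Proof.
by move=> fg; apply/levelSP; split=> [|b]; [rewrite (negbTE fg)|exact: level0].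
Qed.

Lemma level1_genb : level_nbhd 1 1 genb. Proof. exact: level1P. Qed.
Lemma level2_genc : level_nbhd 2 1 genc.
Proof.
rewrite gencE -pair1; apply: level_pair; first exact: level1_genb.
by apply: level1P; rewrite flips_genc.
Qed.
Lemma level2_genz : level_nbhd 2 1 genz.
Proof. by rewrite -pair1; apply: level_pair => //; exact: level1P. Qed.

Lemma level1M n g h : level_nbhd n 1 g -> level_nbhd n 1 h -> level_nbhd n 1 (g * h).
Proof. by move=> g1 h1; have := levelM g1 h1; rewrite mulg1. Qed.

(** The witness is [(x, 1)] for the commutator [x = a c a c = (cb, bc)], which is trivial on level 2
    and has trivial dihedral image. Its [kappa] is [chi (cb)], which is true. *)
Lemma level3_genz : exists h,
  [/\ gamma h, level_nbhd 3 1 h & dih h = (false, false, true)].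
Proof.
have [Ga Gb Gc] := And3 gamma_gena gamma_genb gamma_genc.
pose x := gena * genc * gena * genc; have Gx : gamma x by do !apply: gammaM.
have xE : x = pair_aut (genc * genb) (genb * genc).
  by rewrite /x {1 2}gencE sigma_pair pairM.
have Lx : level_nbhd 2 1 x.
  rewrite xE -pair1; have c1 := level_nbhdW (leqnSn 1) level2_genc.
  by apply: level_pair; apply: level1M => //; exact: level1_genb.
have chib : chi genb = true by rewrite /chi !sgn_genb.
have chic : chi genc = false by rewrite /chi !sgn_genc.
have px : dih x = (false, false, false).
  rewrite xE /dih !sgn_pair !sgnM !sgn_genb !sgn_genc /kappa !sec_pair !secM !chiM.
  by rewrite flips_genc !sec_genb !sec_genc.
exists (pair_aut x 1); split; first exact: gamma_pair1.
  by rewrite -[X in level_nbhd _ X _]pair1; exact: level_pair.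
have s1 : sgn 1 x = false by exact: (congr1 fst (congr1 fst px)).
rewrite /dih !sgn_pair !sgn1 s1 /kappa !sec_pair sec1 chi1 xE sec_pair chiM chib chic.
by rewrite addbF sgn0.
Qed.

(** Triviality of [g] on more levels leaves fewer dihedral images: for [n <= 1] all of [b], [c], [z]
    are trivial on level [n]; for [n = 2] only [c] and [z] are needed; for [n = 3] only [kappa] can
    survive, and [level3_genz] realizes it; from [n = 4] on the image is trivial. *)
Lemma dih_correction n g : inG g -> level_nbhd n 1 g ->
  exists h, [/\ gamma h, level_nbhd n 1 h & dih h = dih g].
Proof.
move=> Gg; have sg m : m < n -> level_nbhd n 1 g -> sgn m g = false.
  by move=> mn g1; rewrite -(level_sgn mn g1) sgn1.
case: n Gg sg => [|[|[|[|n]]]] Gg sg g1.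
- exists (rep (dih g)); split; [exact: gamma_rep|exact: level0|exact: dih_rep].
- exists (rep (dih g)); split; [exact: gamma_rep| |exact: dih_rep].
  apply: level1P; rewrite /rep !flipsE.
  by do 3!case: ifP => _; rewrite ?flips_genc ?flips1.
- exists (rep (dih g)); split; [exact: gamma_rep| |exact: dih_rep].
  rewrite /rep /dih sg //= mul1g; apply: level1M; case: ifP => // _.
    exact: level2_genc.
  exact: level2_genz.
- have [h [Gh h1 ph]] := level3_genz.
  rewrite /dih !sg //; case: (kappa g); first by exists h; rewrite -/(dih h).
  by exists 1; rewrite -/(dih 1) dih1; split=> //; exact: gamma1.
- exists 1; rewrite {2}/dih !sg // -(level_kappa _ g1) // kappa1 dih1.
  by split=> //; exact: gamma1.
Qed.

(** Matching [dih] as well carries the induction: once the second section is approximated with its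
    exact dihedral image, the first section of the remainder has trivial image, so [gamma_pair1]
    lifts its approximation. *)
Lemma gamma_dense n g : inG g ->
  exists h, [/\ gamma h, level_nbhd n h g & dih h = dih g].
Proof.
elim: n g => [|n IHn] g Gg.
  have [h [Gh _ ph]] := dih_correction Gg (level0 1 g).
  by exists h; split=> //; exact: level0.
(* An approximation with the wrong dihedral image can be repaired afterwards by [dih_correction]. *)
suff [h Gh hg] : exists2 h, gamma h & level_nbhd n.+1 h g.
  have hg1 : level_nbhd n.+1 1 (h^-1 * g) by rewrite -(mulVg h); apply: levelM.
  have [r [Gr r1 pr]] := dih_correction (inGM (inGV (gamma_inG Gh)) Gg) hg1.
  exists (h * r); split; first exact: gammaM.
    apply: level_trans hg; rewrite -[X in level_nbhd _ _ X]mulg1.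
    by apply: levelM => //; exact: level_sym.
  have Lh := gamma_inG Gh 0%N; rewrite dihM // pr -dihM ?mulVKg //.
wlog fg : g Gg / ~~ flips g.
  move=> wg; case: (boolP (flips g)) => [fg|]; last exact: wg.
  have [||h Gh hg] := wg (gena * g); first exact: inGM inG_gena Gg.
    by rewrite flipsM fg.
  exists (gena * h); first exact: gammaM gamma_gena Gh.
  by rewrite -(mul1g g) -gena2 -mulgA; apply: levelM.
have [v [Gv vg pv]] := IHn (sec g true) (inG_sec true Gg).
have [d Gdv] := gamma_lift Gv.
have Gg' := inGM (inGV (gamma_inG Gdv)) Gg; move: Gg'.
rewrite -{1}(pair_sec fg) pairV pairM => /inG_pairE[Gu _ /linked_dih].
rewrite [in RHS]dih_div ?eqxx; [|exact: gamma_inG|exact: inG_sec|exact: pv].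
move=> /eqP pu; have [u [Gu' ug pu']] := IHn _ Gu.
rewrite {}pu in pu'.
exists (pair_aut (rep d) v * pair_aut u 1).
  by apply: gammaM => //; exact: gamma_pair1.
rewrite pairM mulg1 -(pair_sec fg); apply: level_pair => //.
by rewrite -[X in level_nbhd _ _ X](mulVKg (rep d)); apply: levelM.
Qed.

Lemma closed_subgroupE :
  closed_subgroup [set gena; genb; genc] = inG :> set tree_aut.
Proof.
apply/seteqP; split=> [g /closure_autP cg n|g Gg]; last first.
  apply/closure_autP => n; have [h [Gh hg _]] := gamma_dense n Gg.
  by exists h => //; exact: level_sym.
have [h Gh hg] := cg (n + 5)%N.
by rewrite (level_Gn (leqnn _) hg); exact: gamma_inG.
Qed.

(** * The normalizer *)

Definition diag x := pair_aut x x.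

Definition Nm x : Prop :=
  (forall g, inG g -> inG (x * g * x^-1)) /\ (forall g, inG g -> inG (x^-1 * g * x)).

(* The elements of the normalizer that act trivially on the dihedral group. *)
Definition N0 x : Prop := Nm x /\ forall g, inG g -> kappa (x * g * x^-1) = kappa g.

Lemma conjM (gT : groupType) (x y g : gT) :
  x * y * g * (x * y)^-1 = x * (y * g * y^-1) * x^-1.
Proof. by rewrite invgM !mulgA. Qed.

Lemma conjMg (gT : groupType) (x g h : gT) :
  x * (g * h) * x^-1 = (x * g * x^-1) * (x * h * x^-1).
Proof. by rewrite !mulgA mulgVK. Qed.

Lemma conjVg (gT : groupType) (x g : gT) : x * g^-1 * x^-1 = (x * g * x^-1)^-1.
Proof. by rewrite !invgM invgK mulgA. Qed.

Lemma NmV x : Nm x -> Nm x^-1.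
Proof. by move=> [x1 x2]; split; rewrite ?invgK. Qed.

Lemma NmM x y : Nm x -> Nm y -> Nm (x * y).
Proof.
move=> [x1 x2] [y1 y2]; split=> g Gg; first by rewrite conjM; apply/x1/y1.
have := y2 _ (x2 _ Gg); by rewrite invgM !mulgA.
Qed.

Lemma inG_Nm g : inG g -> Nm g.
Proof.
move=> Gg; have GV := inGV Gg.
by split=> h Gh; apply: inGM => //; apply: inGM.
Qed.

Lemma N0_Nm x : N0 x -> Nm x. Proof. by case. Qed.

Lemma N0V x : N0 x -> N0 x^-1.
Proof.
move=> [Nx kx]; split; first exact: NmV.
move=> g Gg; rewrite -(kx (x^-1 * g * x^-1^-1)); last by case: (NmV Nx) => /(_ _ Gg).
by congr kappa; rewrite invgK !mulgA mulgV mul1g mulgK.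
Qed.

Lemma N0M x y : N0 x -> N0 y -> N0 (x * y).
Proof.
move=> [Nx kx] [Ny ky]; split; first exact: NmM.
by move=> g Gg; rewrite conjM kx ?ky //; apply: Ny.1.
Qed.

Lemma kappaJ g h : inG g -> inG h ->
  kappa (h * g * h^-1) = kappa g (+) (sgn 2 h && sgn 1 g) (+) (sgn 2 g && sgn 1 h).
Proof.
move=> Gg Gh; rewrite !kappaM ?kappaV ?(GnM (Gh _)) // sgnV !sgnM.
by case_bits.
Qed.

(** An element of the group acts on the dihedral group by an inner automorphism, which is trivial
    when the image is central. Conjugating [b] and [c] detects the two signs. *)
Lemma inG_N0P g : inG g -> N0 g <-> sgn 1 g = false /\ sgn 2 g = false.
Proof.
move=> Gg; split=> [[_ kg]|[g1 g2]].
  have := kg _ inG_genc; have := kg _ inG_genb.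
  rewrite !kappaJ //; [|exact: inG_genc|exact: inG_genb].
  by rewrite !sgn_genb !sgn_genc !andbT !andbF kappa_genb kappa_genc /= !addbF.
split; first exact: inG_Nm.
by move=> h Gh; rewrite kappaJ // g1 g2 andbF !addbF.
Qed.

Lemma N01 : N0 1.
Proof. by apply/inG_N0P; [exact: inG1|rewrite !sgn1]. Qed.

Lemma N0_linked u v p q : N0 u -> N0 v -> inG p -> inG q ->
  linked (u * p * u^-1) (v * q * v^-1) = linked p q.
Proof. by move=> [_ ku] [_ kv] Gp Gq; rewrite /linked !sgnJ ku // kv. Qed.

Lemma linkedV_N0 p : inG p -> N0 p -> linked p p^-1.
Proof.
move=> Gp /(inG_N0P Gp)[p1 p2].
by rewrite /linked !sgnV kappaV // p1 p2 !eqxx.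
Qed.

Lemma conj_pair_sigma u v :
  pair_aut u v * sigma * (pair_aut u v)^-1 = pair_aut (u * v^-1) (v * u^-1) * sigma.
Proof.
rewrite pairV; apply: sec_ext => [|[]]; first by rewrite !flipsE.
  by rewrite !(secM, sec_pair, sec_sigma, flipsM) ?mulg1.
by rewrite !(secM, sec_pair, sec_sigma, flipsM) ?mulg1.
Qed.

(** Conjugating [sigma] produces the pair of [u * v^-1] and its inverse; these are linked because
    the image of [u * v^-1] is central of order at most 2. On elements fixing the first level, [u]
    and [v] preserve linkage since they do not change [kappa]. *)
Lemma Nm_pair u v : N0 u -> N0 v -> inG (u * v^-1) -> Nm (pair_aut u v).
Proof.
suff fwd u' v' g : N0 u' -> N0 v' -> inG (u' * v'^-1) -> inG g ->
    inG (pair_aut u' v' * g * (pair_aut u' v')^-1).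
  move=> Nu Nv Guv; split=> g Gg; first exact: fwd.
  have := fwd u^-1 v^-1 g (N0V Nu) (N0V Nv); rewrite -pairV !invgK; apply=> //.
  by have [_ /(_ _ (inGV Guv))] := N0_Nm Nv; rewrite invgM invgK mulgA mulVg mul1g.
move=> Nu Nv Guv; wlog fg : g / ~~ flips g.
  move=> wg Gg; case: (boolP (flips g)) => [fg|]; last by move=> /wg; apply.
  rewrite -[g](mulKg sigma) conjMg; apply: inGM; last first.
    by apply: wg; [rewrite flipsM fg|exact: inGM inG_sigma Gg].
  rewrite conjVg; apply: inGV; rewrite conj_pair_sigma; apply: inGM inG_sigma.
  have GV := inGV Guv; rewrite invgM invgK in GV.
  apply/inG_pairE; split=> //; rewrite -[v' * _]invgK invgM invgK.
  by apply: linkedV_N0 => //; apply: N0M => //; exact: N0V.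
rewrite -{1 2}(pair_sec fg) => /inG_pairE[Gp Gq lpq].
rewrite pairV !pairM; apply/inG_pairE; split.
- exact: (N0_Nm Nu).1.
- exact: (N0_Nm Nv).1.
- by rewrite N0_linked.
Qed.

(** The representative of the image of [p] under the exchange of [b] and [c] will do. Hence any [p]
    in the group occurs as a first section. *)
Lemma exists_linked p : inG p -> exists2 q, inG q & linked p q.
Proof.
move=> Gp; exists (rep (sgn 2 p, sgn 1 p, kappa p (+) (sgn 1 p && sgn 2 p))).
  exact: inG_rep.
by have [p1 p2 p3] := dih_rep (sgn 2 p, sgn 1 p, kappa p (+) (sgn 1 p && sgn 2 p));
  rewrite /linked p1 p2 p3 !eqxx.
Qed.

Lemma Nm_pair_swap u v : Nm (pair_aut u v) -> Nm (pair_aut v u).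
Proof.
have Ns := inG_Nm inG_sigma.
by move=> Nuv; rewrite -sigma_pair; apply: NmM (Ns); exact: NmM.
Qed.

(** Conjugating [(p, q)] with [p] and [q] linked controls [u] and [v] separately, and conjugating
    [sigma] gives [u * v^-1]. Linkage before and after conjugation transfers invariance of [kappa]
    from [u] to [v]. *)
Lemma Nm_pair_inv u v : Nm (pair_aut u v) ->
  [/\ Nm u, inG (u * v^-1) & N0 u -> N0 v].
Proof.
have half u' v' p : Nm (pair_aut u' v') -> inG p -> inG (u' * p * u'^-1).
  move=> [N1 _] Gp; have [q Gq lpq] := exists_linked Gp.
  have /N1 : inG (pair_aut p q) by apply/inG_pairE.
  by rewrite pairV !pairM => /inG_pairE[].
have Nm1 u' v' : Nm (pair_aut u' v') -> Nm u'.
  move=> Nu'; split=> p; first exact: half Nu'.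
  by move: (NmV Nu'); rewrite pairV => /half/[apply]; rewrite invgK.
move=> Nuv; split; first exact: Nm1 Nuv.
  have /Nuv.1 := inG_sigma; rewrite conj_pair_sigma => /inGM/(_ inG_sigma).
  by rewrite -mulgA sigmaK mulg1 => /inG_pairE[].
move=> [Nu ku]; split; first exact: Nm1 (Nm_pair_swap Nuv).
move=> q Gq; have [p Gp] := exists_linked Gq; rewrite linkedC => lpq.
have /Nuv.1 : inG (pair_aut p q) by apply/inG_pairE.
rewrite pairV !pairM => /inG_pairE[_ _]; move: lpq.
by rewrite /linked !sgnJ ku // => /and3P[_ _ /eqP ->] /and3P[_ _ /eqP].
Qed.

(** This is applied to conjugates of [a]. The two sections are inverse to each other, so linkage
    forces [sgn 1] and [sgn 2] to agree on them, and the two terms of [kappa] cancel. *)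
Lemma kappa_involution y : inG y -> flips y -> y * y = 1 -> kappa y = false.
Proof.
move=> Gy fy yy; have := congr1 (sec^~ false) yy.
rewrite secM sec1 fy /= => /mulg1_eq pq.
have /and3P[/eqP + _ _] := inG_linked Gy.
rewrite -pq sgnV => e1; rewrite /kappa -pq secV chiV chi_sec e1 addbb andbF addbF.
exact: addbb.
Qed.

Lemma kappa_conj_level n x g h : 4 <= n -> level_nbhd n g h ->
  kappa (x * g * x^-1) = kappa (x * h * x^-1).
Proof. by move=> n4 gh; apply: (level_kappa n4); do !apply: levelM. Qed.

(** Conjugation preserves signs, so both sides obey the same cocycle rule and need comparison only
    on the generators. Density at level 4, which determines [kappa] and the signs involved, extends
    the equality to the closure. *)
Lemma kappa_conj x g : Nm x -> inG g ->
  kappa (x * g * x^-1) = kappa g (+) (kappa (x * genb * x^-1) && sgn 1 g)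
                                 (+) (kappa (x * genc * x^-1) && sgn 2 g).
Proof.
move=> Nx Gg; pose H : set tree_aut := [set h | inG h /\
  kappa (x * h * x^-1) = kappa h (+) (kappa (x * genb * x^-1) && sgn 1 h)
                                 (+) (kappa (x * genc * x^-1) && sgn 2 h)].
have HM h h' : H h -> H h' -> H (h * h').
  move=> [Gh kh] [Gh' kh']; split; first exact: inGM.
  rewrite conjMg (kappaM _ (Nx.1 _ Gh 0%N)) (kappaM _ (Gh 0%N)) kh kh' !sgnJ !sgnM.
  by case_bits.
suff GH : gamma `<=` H.
  have [h [/GH[_ kh] hg _]] := gamma_dense 4 Gg.
  have le3 m : m < 4 -> sgn m h = sgn m g by move=> m4; exact: level_sgn hg.
  by rewrite -(kappa_conj_level x _ hg) // -(level_kappa _ hg) // kh !le3.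
apply: gamma_ind; first split => //.
- by split; [exact: inG1|rewrite mulg1 mulgV kappa1 !sgn1 !andbF].
- move=> h [Gh kh]; split; first exact: inGV.
  rewrite conjVg !kappaV ?(Nx.1 _ Gh 0%N) // kh !sgnJ !sgnV.
  by case_bits.
- split; first exact: inG_gena.
  rewrite kappa_gena !sgn_gena !andbF; apply: kappa_involution.
  + exact: Nx.1 inG_gena.
  + by rewrite !flipsE addbAC addbb.
  + by rewrite -conjMg gena2 mulg1 mulgV.
- by split; [exact: inG_genb|rewrite kappa_genb !sgn_genb andbT andbF addbF].
- by split; [exact: inG_genc|rewrite kappa_genc !sgn_genc andbT andbF addbF].
Qed.

Lemma N0_gens x : Nm x ->
  kappa (x * genb * x^-1) = false -> kappa (x * genc * x^-1) = false -> N0 x.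
Proof. by move=> Nx kb kc; split=> // g Gg; rewrite kappa_conj // kb kc !addbF. Qed.

Lemma Nm_adjust x : Nm x -> exists2 h, inG h & N0 (x * h).
Proof.
(* Conjugation by [b] turns [c] into [c z], and conjugation by [c] turns [b] into [b z]; so the
   exponent of each generator is the defect of the other one. *)
move=> Nx; pose d := (kappa (x * genc * x^-1), kappa (x * genb * x^-1), false).
have Gh : inG (rep d) by exact: inG_rep.
have [h1 h2 _] := dih_rep d.
exists (rep d) => //; split; first exact: NmM Nx (inG_Nm Gh).
move=> g Gg; rewrite conjM kappa_conj //; last exact: (inG_Nm Gh).1.
by rewrite (kappaJ Gg Gh) !sgnJ h1 h2; case_bits.
Qed.

(** * Diagonal elements, the invariant [k0], and the elements w_0 and w_1 *)

Definition k0 x : bool := sgn 1 x (+) sgn 2 x.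

Lemma k0M x y : k0 (x * y) = k0 x (+) k0 y.
Proof. by rewrite /k0 !sgnM; case_bits. Qed.

Lemma k0V x : k0 x^-1 = k0 x.
Proof. by rewrite /k0 !sgnV. Qed.

Lemma sgn_diag n x : sgn n (diag x) = false.
Proof. by case: n => // n; rewrite sgn_pair addbb. Qed.

Lemma k0_diag x : k0 (diag x) = false.
Proof. by rewrite /k0 !sgn_diag. Qed.

Lemma diagM x y : diag (x * y) = diag x * diag y.
Proof. by rewrite pairM. Qed.

Lemma chi_conj x g : chi (sec (x * g * x^-1) false) =
  chi (sec g (flips x)) (+) (flips g && k0 x).
Proof.
rewrite !secM secV !chiM chiV flipsV (chi_sec x (_ (+) flips g)).
rewrite (chi_sec x (false (+) _)) -/(k0 x).
by case: (flips x); case: (flips g); case: (k0 x); case_bits.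
Qed.

Lemma sec_diag x b : sec (diag x) b = x.
Proof. by rewrite sec_pair; case: b. Qed.

Lemma sec_diag_conj x g b :
  sec (diag x * g * (diag x)^-1) b = x * sec g b * x^-1.
Proof. by rewrite !secM secV !flipsE !addbF !sec_diag. Qed.

(** When [k0 x] holds, [diag x] changes [kappa] exactly as conjugation by [c] does. This is why the
    factor [c] in [w_0 = c (w_0, w_0)] makes [w_0] act trivially. *)
Lemma kappa_diag_conj x g : Gn 0 g ->
  kappa (diag x * g * (diag x)^-1) = kappa g (+) (sgn 1 g && k0 x).
Proof.
move=> Lg; rewrite /kappa !sec_diag_conj !chi_conj (chi_sec (sec g false) (flips x)).
rewrite (chi_sec (sec g true) (flips x)) !Gn0_sgn //.
rewrite (sgnS 0 g) !sgn0; case: (flips x); case: (flips (sec g false));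
by case: (flips (sec g true)); case: (k0 x); case_bits.
Qed.

Lemma kappa_genc_conj g : Gn 0 g ->
  kappa (genc * g * genc^-1) = kappa g (+) sgn 1 g.
Proof.
move=> Lg; have Lc := inG_genc 0%N.
rewrite !kappaM ?GnM // kappaV // sgnV !sgnM !sgn_genc kappa_genc /=.
case_bits.
Qed.

Definition genw0 := rec_aut (fun b => if b then genc else genb) xpredT.

Lemma genw0E : genw0 = genc * diag genw0.
Proof.
rewrite {1}gencE pairM; apply: tree_autP => -[|[] t] //.
Qed.

Lemma k0_genw0 : k0 genw0.
Proof. by rewrite genw0E k0M k0_diag /k0 !sgn_genc. Qed.

Lemma genw0_conj g :
  genw0 * g * genw0^-1 = genc * (diag genw0 * g * (diag genw0)^-1) * genc^-1.
Proof. by rewrite {1 2}genw0E conjM. Qed.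

Lemma Gn0_diag_conj x g : Gn 0 (diag x * g * (diag x)^-1) = Gn 0 g.
Proof. by rewrite /Gn !sec_diag_conj !sgnJ. Qed.

Lemma kappa_genw0_conj g : Gn 0 g -> kappa (genw0 * g * genw0^-1) = kappa g.
Proof.
move=> Lg; rewrite genw0_conj kappa_genc_conj ?Gn0_diag_conj //.
by rewrite kappa_diag_conj // sgnJ k0_genw0 andbT -addbA addbb addbF.
Qed.

(** Up to conjugation by [c], which lies in the group, [w_0] conjugates both sections by [w_0]
    itself. The induction thus reproduces the same claim one level down, and linkage survives
    because [kappa] is invariant. *)
Lemma Gn_genw0_conj n g : Gn n (genw0 * g * genw0^-1) = Gn n g.
Proof.
have Gc := inG_genc.
rewrite genw0_conj (GnMr _ (inGV Gc n)) (GnMl _ (Gc n)).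
elim: n g => [|n IHn] g; first exact: Gn0_diag_conj.
have {}IHn h : Gn n (genw0 * h * genw0^-1) = Gn n h.
  by rewrite genw0_conj (GnMr _ (inGV Gc n)) (GnMl _ (Gc n)).
rewrite !GnS !sec_diag_conj !IHn; case G0 : (Gn n _) => //; case G1 : (Gn n _) => //=.
by rewrite /linked !sgnJ !kappa_genw0_conj //; apply: GnW; eassumption.
Qed.

Lemma N0_genw0 : N0 genw0.
Proof.
split; [split=> g Gg n|move=> g Gg].
- by rewrite Gn_genw0_conj.
- by rewrite -Gn_genw0_conj !mulgA mulgV mul1g mulgK.
- exact: kappa_genw0_conj (Gg 0%N).
Qed.

Definition genw1 := pair_aut 1 genz.

Lemma N0_genz : N0 genz.
Proof. by apply/(inG_N0P inG_genz); rewrite !sgn_genz. Qed.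

Lemma N0_genw1 : N0 genw1.
Proof.
have conj_comm x : genw1 * x = x * genw1 -> genw1 * x * genw1^-1 = x.
  by move=> ->; rewrite mulgK.
apply: N0_gens.
- apply: Nm_pair N01 N0_genz _; rewrite mul1g; exact/inGV/inG_genz.
- by rewrite conj_comm ?kappa_genb // !pairM !mulg1 !mul1g.
- by rewrite conj_comm ?kappa_genc // gencE !pairM mul1g mulg1 genzc.
Qed.

Lemma genw1K : genw1 * genw1 = 1.
Proof. by rewrite pairM genz2 mulg1 pair1. Qed.

Lemma k0_genw1 : k0 genw1 = false.
Proof. by rewrite /k0 !sgn_pair !sgn_genz !sgn1. Qed.

Lemma Nm_diag x : N0 x -> Nm (diag x).
Proof. by move=> Nx; apply: Nm_pair => //; rewrite mulgV; exact: inG1. Qed.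

Lemma N0_diag x : N0 x -> k0 x = false -> N0 (diag x).
Proof.
move=> Nx kx; split; first exact: Nm_diag.
by move=> g /(_ 0%N) Lg; rewrite kappa_diag_conj // kx andbF addbF.
Qed.

Lemma inG_pair1 g : inG g -> dih g = (false, false, false) -> inG (pair_aut 1 g).
Proof.
move=> Gg [g1 g2 g3]; apply/inG_pairE; split=> //; first exact: inG1.
by rewrite /linked g1 g2 g3 !sgn1 kappa1.
Qed.

Lemma inG_diag g : inG g -> N0 g -> inG (diag g).
Proof.
move=> Gg /(inG_N0P Gg)[g1 g2]; apply/inG_pairE; split=> //.
by rewrite /linked g1 g2 addbF !eqxx.
Qed.

Lemma Nm_decomp x : Nm x -> exists k u g,
  [/\ N0 u, inG g & x = (if k then genw1 else 1) * diag u * g].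
Proof.
wlog fx : x / ~~ flips x.
  move=> wx Nx; case: (boolP (flips x)) => [fx|]; last by move=> /wx; apply.
  have [||k [u [g [Nu Gg xE]]]] := wx (x * sigma); first by rewrite flipsM fx.
    by apply: NmM => //; exact/inG_Nm/inG_sigma.
  exists k, u, (g * sigma); split=> //; first exact: inGM inG_sigma.
  by rewrite mulgA -xE -mulgA sigmaK mulg1.
move=> Nx; have [Nu0 _ _] : [/\ Nm (sec x false), inG (sec x false * (sec x true)^-1) &
    N0 (sec x false) -> N0 (sec x true)].
  by apply: Nm_pair_inv; rewrite pair_sec.
(* Right multiplication by [(h, q)] brings the first section into [N0], and then the second one
   follows. *)
have [h Gh Nu] := Nm_adjust Nu0; have [q Gq lhq] := exists_linked Gh.
have Ghq : inG (pair_aut h q) by apply/inG_pairE.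
set u := sec x false * h in Nu; pose v := sec x true * q.
have xE : x * pair_aut h q = pair_aut u v by rewrite -{1}(pair_sec fx) pairM.
have [_ Guv Nv] : [/\ Nm u, inG (u * v^-1) & N0 u -> N0 v].
  by apply: Nm_pair_inv; rewrite -xE; apply: NmM => //; exact: inG_Nm.
have {}Nv := Nv Nu; clearbody u v; pose e := v * u^-1.
have Ge : inG e by have := inGV Guv; rewrite invgM invgK.
have [e1 e2] : sgn 1 e = false /\ sgn 2 e = false.
  by apply/(inG_N0P Ge); apply: N0M => //; exact: N0V.
(* The image of [e] is central, hence the power [kappa e] of [genz]. Splitting it off yields the
   factor [genw1] and leaves a pair in the group. *)
pose z := rep (false, false, kappa e); pose g := pair_aut 1 (z^-1 * e).
have Gg : inG g.
  apply: inG_pair1; first exact: inGM (inGV (inG_rep _)) Ge.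
  by apply: dih_repV => //; rewrite /dih e1 e2.
exists (kappa e), u, ((diag u)^-1 * g * diag u * (pair_aut h q)^-1); split=> //.
  apply: inGM; last exact: inGV.
  exact: (Nm_diag Nu).2.
rewrite !mulgA mulgK -[LHS](mulgK (pair_aut h q)) xE; congr (_ * _).
have -> : (if kappa e then genw1 else 1) = pair_aut 1 z.
  by rewrite /z /rep /= !mul1g; case: (kappa e); rewrite ?pair1.
by rewrite !pairM !mul1g /e !mulgA mulgV mul1g mulgVK.
Qed.

(** * The normalizer modulo the group *)

Definition eqG x y : Prop := inG (x^-1 * y).

Lemma eqG_refl x : eqG x x.
Proof. by rewrite /eqG mulVg; exact: inG1. Qed.

Lemma eqG_sym x y : eqG x y -> eqG y x.
Proof. by move=> /inGV; rewrite invgM invgK. Qed.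

Lemma eqG_trans y x z : eqG x y -> eqG y z -> eqG x z.
Proof. by move=> xy /(inGM xy); rewrite mulgA mulgK. Qed.

Lemma eqGM x x' y y' : Nm y' -> eqG x y -> eqG x' y' -> eqG (x * x') (y * y').
Proof.
move=> [_ N2] /N2 xy x'y'; rewrite /eqG invgM.
by have := inGM x'y' xy; rewrite !mulgA mulgK.
Qed.

Lemma eqG_mulr x g : inG g -> eqG x (x * g).
Proof. by rewrite /eqG mulKg. Qed.

Lemma inG_closed x : (forall n, exists2 g, inG g & level_nbhd n g x) -> inG x.
Proof.
move=> cx n; have [g Gg gx] := cx (n + 5)%N.
by rewrite -(level_Gn (leqnn _) gx).
Qed.

(** The commutator is [(1, x^-1 z^-1 x z)], and its second section has trivial dihedral image
    because [x] acts trivially there. *)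
Lemma genw1_comm x : N0 x -> inG ((genw1 * diag x)^-1 * (diag x * genw1)).
Proof.
move=> Nx; rewrite !pairM pairV pairM mul1g mulg1 mulVg invgM.
have GzV := inGV inG_genz; have [Nm kx] := N0V Nx.
have Gc : inG (x^-1 * genz^-1 * x) by exact: (N0_Nm Nx).2.
apply: inG_pair1; first by rewrite mulgA; exact: inGM inG_genz.
have := kx _ GzV; rewrite invgK => kc.
rewrite mulgA dihM // /dih kc kappaV ?inG_genz // kappa_genz.
by rewrite !sgnM !sgnV !sgn_genz !addbF !addbb.
Qed.

Lemma iter_diagM n x y : iter n diag (x * y) = iter n diag x * iter n diag y.
Proof. by elim: n => //= n ->; exact: diagM. Qed.

Lemma level_iter_diag n m x : level_nbhd m 1 x ->
  level_nbhd (n + m) 1 (iter n diag x).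
Proof.
move=> x1; elim: n => //= n IHn.
by rewrite -pair1; apply: level_pair.
Qed.

Lemma iter_diag_inG n g : inG g -> N0 g -> inG (iter n diag g) /\ N0 (iter n diag g).
Proof.
move=> Gg Ng; elim: n => //= n [Gn Nn].
have [g1 g2] := (inG_N0P Gn).1 Nn.
by split; [exact: inG_diag|apply: N0_diag; rewrite // /k0 g1 g2].
Qed.

(** Modulo the group, [x] is a product of [diag u] and an involution [w] that commutes with
    [diag u], so only [diag u] contributes to the square. *)
Lemma diag_sqrt x : N0 x ->
  exists u g, [/\ N0 u, inG g, N0 g & x * x = diag (u * u) * g].
Proof.
move=> Nx; have [k [u [g [Nu Gg xE]]]] := Nm_decomp (N0_Nm Nx).
set w := if k then genw1 else 1 in xE.
have Nw : N0 w by rewrite /w; case: k {w xE}; [exact: N0_genw1|exact: N01].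
have Nu' := Nm_diag Nu; have Nwu := NmM (N0_Nm Nw) Nu'.
have wC : eqG (diag u * w) (w * diag u).
  apply: eqG_sym; rewrite /w; case: k {w xE Nw Nwu}; first exact: genw1_comm.
  by rewrite mul1g mulg1; exact: eqG_refl.
have ww : w * w = 1 by rewrite /w; case: k {w xE Nw Nwu wC}; rewrite ?genw1K ?mulg1.
have xw : eqG x (w * diag u) by apply: eqG_sym; rewrite xE; exact: eqG_mulr.
have sq : eqG (x * x) (diag (u * u)).
  apply: (eqG_trans (eqGM Nwu xw xw)).
  have -> : w * diag u * (w * diag u) = w * (diag u * w) * diag u by rewrite !mulgA.
  have -> : diag (u * u) = w * (w * diag u) * diag u.
    by rewrite diagM !mulgA ww mul1g.
  apply: eqGM (eqG_refl _) => //; apply: eqGM wC => //; exact: eqG_refl.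
have Nuu : N0 (diag (u * u)) by apply: N0_diag; [exact: N0M|rewrite k0M addbb].
exists u, ((diag (u * u))^-1 * (x * x)); split=> //; last by rewrite mulVKg.
  exact: eqG_sym sq.
by apply: N0M (N0V Nuu) _; exact: N0M.
Qed.

Lemma sqr_iter_diag n x : N0 x ->
  exists t g, [/\ inG g, N0 g & x * x = iter n diag t * g].
Proof.
elim: n x => [|n IHn] x Nx.
  by exists (x * x), 1; split; [exact: inG1|exact: N01|rewrite mulg1].
have [u [g [Nu Gg Ng ->]]] := diag_sqrt Nx.
have [t [h [Gh Nh ->]]] := IHn u Nu; exists t, (diag h * g).
have [h1 h2] := (inG_N0P Gh).1 Nh.
split; last by rewrite diagM mulgA.
  by apply: inGM => //; exact: inG_diag.
by apply: N0M => //; apply: N0_diag; rewrite // /k0 h1 h2.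
Qed.

(** For every [n] the square is an [n]-fold diagonal times an element of the group. The diagonal is
    trivial on level [n], and the group is closed. *)
Lemma inG_sqr x : N0 x -> inG (x * x).
Proof.
move=> Nx; apply: inG_closed => n; have [t [g [Gg _ ->]]] := sqr_iter_diag n Nx.
exists g => //; rewrite -{1}[g]mul1g; apply: levelM => //.
by have := @level_iter_diag n 0 t (level0 1 t); rewrite addn0.
Qed.

(* Groups of exponent two are abelian. *)
Lemma eqG_comm x y : N0 x -> N0 y -> eqG (x * y) (y * x).
Proof.
move=> Nx Ny; have NxV := N0V Nx; have NyV := N0V Ny.
have -> : eqG (x * y) (y * x) =
    inG (y^-1 * x^-1 * (y^-1 * x^-1) * (x * (y * y) * x^-1) * (x * x)).
  by rewrite /eqG; congr inG; rewrite invgM !mulgA !mulgVK.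
apply: inGM (inG_sqr Nx); apply: inGM (inG_sqr (N0M NyV NxV)) _.
exact: (N0_Nm Nx).1 (inG_sqr Ny).
Qed.

(** * The sequence w_i and its finite products *)

Definition wseq (n : nat) : tree_aut :=
  if n is m.+1 then iter m diag genw1 else genw0.

Lemma wseqS n : wseq n.+2 = diag (wseq n.+1). Proof. by []. Qed.

Lemma N0_wseq n : N0 (wseq n) /\ (0 < n -> k0 (wseq n) = false).
Proof.
case: n => [|n]; first by split=> //; exact: N0_genw0.
elim: n => [|n [Nn kn]]; first by split; [exact: N0_genw1|move=> _; exact: k0_genw1].
by rewrite wseqS; split; [apply: N0_diag; rewrite // kn|rewrite k0_diag].
Qed.

Lemma level_wseq n : level_nbhd n 1 (wseq n).
Proof.
case: n => [|n]; first exact: level0.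
by rewrite -[X in level_nbhd X]addn1; apply: level_iter_diag; exact: level1P.
Qed.

Definition wprod (k : nat -> bool) (n : nat) : tree_aut :=
  \prod_(i < n) (if k i then wseq i else 1).

Lemma wprod0 k : wprod k 0 = 1. Proof. by rewrite /wprod big_ord0. Qed.

Lemma wprodS k n : wprod k n.+1 = wprod k n * (if k n then wseq n else 1).
Proof. by rewrite /wprod big_ord_recr. Qed.

Lemma N0_wprod k n : N0 (wprod k n).
Proof.
elim: n => [|n IHn]; first by rewrite wprod0; exact: N01.
rewrite wprodS; apply: N0M => //; case: (k n); last exact: N01.
by case: (N0_wseq n).
Qed.

Lemma k0_wprod k n : k0 (wprod k n.+1) = k 0.
Proof.
elim: n => [|n IHn].
  by rewrite wprodS wprod0 mul1g; case: (k 0); rewrite ?k0_genw0 // /k0 !sgn1.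
rewrite wprodS k0M IHn; case: (k n.+1); last by rewrite /k0 !sgn1 !addbF.
by rewrite (N0_wseq n.+1).2 // addbF.
Qed.

Lemma level_wprod k n m : n <= m -> level_nbhd n (wprod k n) (wprod k m).
Proof.
move=> /subnK <-; elim: (m - n) => // d IHd.
rewrite addSn wprodS; apply: level_trans IHd _.
rewrite -[X in level_nbhd _ X]mulg1; apply: levelM => //.
case: (k _); last exact: level_refl.
by apply: (@level_nbhdW n (d + n)); [exact: leq_addl|exact: level_wseq].
Qed.

Lemma wprod_addb (k l : nat -> bool) n :
  eqG (wprod (fun i => k i (+) l i) n) (wprod k n * wprod l n).
Proof.
elim: n => [|n IHn]; first by rewrite !wprod0 mulg1; exact: eqG_refl.
have Nw := (N0_wseq n).1; set w := wseq n in Nw.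
pose e b := if b then w else 1.
have Ne b : N0 (e b) by case: b => //; exact: N01.
have eM : eqG (e (k n (+) l n)) (e (k n) * e (l n)).
  rewrite /e; case: (k n); case: (l n) => /=; rewrite ?mulg1 ?mul1g;
    do ?exact: eqG_refl.
  by rewrite /eqG invg1 mul1g; exact: inG_sqr.
rewrite !wprodS -/w -!/(e _).
apply: (eqG_trans (eqGM _ IHn eM)); first by apply: N0_Nm; exact: N0M.
rewrite -!mulgA; apply: eqGM (eqG_refl _) _.
  by apply: N0_Nm; apply: N0M => //; apply: N0M => //; exact: N0_wprod.
rewrite !mulgA; apply: eqGM (eqG_refl _); first exact: N0_Nm.
by apply: eqG_comm => //; exact: N0_wprod.
Qed.

(** * Limits *)

Lemma level_lim (p : nat -> tree_aut) :
  (forall n m, n <= m -> level_nbhd n (p n) (p m)) ->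
  exists x, forall n, level_nbhd n (p n) x.
Proof.
move=> pp; pose f t := p (size t) t.
have fE n t : size t <= n -> f t = p n t by move=> tn; rewrite (pp _ _ tn).
have fb : bijective f.
  exists (fun t => (p (size t))^-1 t) => t.
    by rewrite /f size_aut -autM mulVg aut1.
  by rewrite /f size_aut -autM mulgV aut1.
have f0 : f [::] = [::] by rewrite /f aut_root.
have fa s t : adj (f s) (f t) = adj s t.
  rewrite (fE (maxn (size s) (size t)) s) ?leq_maxl //.
  by rewrite (fE (maxn (size s) (size t)) t) ?leq_maxr // aut_adj.
by exists (TreeAut fb f0 fa) => n t tn; exact: fE.
Qed.

Lemma N0_lim (p : nat -> tree_aut) x :
  (forall n, level_nbhd n (p n) x) -> (forall n, N0 (p n)) -> N0 x.
Proof.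
move=> px Np; split; [split=> g Gg|move=> g Gg].
- apply: inG_closed => n; exists (p n * g * (p n)^-1).
    exact: (N0_Nm (Np n)).1.
  by apply: levelM; [exact: levelM|exact: levelV].
- apply: inG_closed => n; exists ((p n)^-1 * g * p n).
    exact: (N0_Nm (Np n)).2.
  by apply: levelM => //; apply: levelM => //; exact: levelV.
- rewrite -((Np 4).2 g Gg); apply/esym/(level_kappa (leqnn 4)).
  by apply: levelM; [exact: levelM|exact: levelV].
Qed.

(** A limit with explicit rate: [w_i] is trivial on level [i], so the product of the first [n]
    factors is already correct on level [n]. *)
Definition is_phi (k : nat -> bool) x : Prop := forall n, level_nbhd n (wprod k n) x.

Lemma is_phi_exists k : exists x, is_phi k x.
Proof. by apply: level_lim => n m; exact: level_wprod. Qed.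

Lemma is_phi_N0 k x : is_phi k x -> N0 x.
Proof. by move=> kx; apply: N0_lim kx _ => n; exact: N0_wprod. Qed.

Lemma is_phi_addb (k l : nat -> bool) x y z : is_phi k x -> is_phi l y ->
  is_phi (fun i => k i (+) l i) z -> eqG z (x * y).
Proof.
move=> kx ly klz; apply: inG_closed => n.
exists ((wprod (fun i => k i (+) l i) n)^-1 * (wprod k n * wprod l n)).
  exact: wprod_addb.
by apply: levelM; [exact: levelV|exact: levelM].
Qed.

Lemma is_phi_k0 k x : is_phi k x -> k0 x = k 0.
Proof.
move=> /(_ 3) kx; rewrite -(k0_wprod k 2) /k0.
by rewrite !(level_sgn _ kx).
Qed.

(** Since [w_(i+1) = diag w_i] for [i >= 1], these are the exponents inside the diagonal once [w_1]
    is split off. Index 0 gets [false] because [w_1] is not the diagonal of [w_0]. *)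
Definition kshift (k : nat -> bool) (i : nat) : bool := if i is j.+1 then k j.+2 else false.

Lemma wprod_kshift k n : k 0 = false ->
  wprod k n.+2 = (if k 1%N then genw1 else 1) * diag (wprod (kshift k) n.+1).
Proof.
move=> kk; elim: n => [|n IHn].
  by rewrite !wprodS !wprod0 kk !mul1g [diag 1]pair1 mulg1.
rewrite wprodS IHn [in RHS]wprodS diagM mulgA; congr (_ * _).
by rewrite /=; case: (k n.+2) => //; rewrite [diag 1]pair1.
Qed.

Lemma is_phi_kshift k x : k 0 = false -> is_phi k x ->
  exists2 y, is_phi (kshift k) y & x = (if k 1%N then genw1 else 1) * diag y.
Proof.
move=> kk kx; have [y ky] := is_phi_exists (kshift k); exists y => //.
apply: tree_autP => t; set n := size t.
rewrite (kx n.+2 t) ?leqW // wprod_kshift //.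
suff /(_ t (leqW (leqnn _))) : level_nbhd n.+1
  ((if k 1%N then genw1 else 1) * diag y)
  ((if k 1%N then genw1 else 1) * diag (wprod (kshift k) n.+1)) by [].
apply: levelM => //; apply: level_pair; apply: level_sym;
  by apply: (@level_nbhdW n n.+1) => //; exact: ky.
Qed.

(** The exponent [k 0] is [k0 x], which vanishes on elements of the group lying in [N0]. Then
    [x = (y, z^(k 1) y)], linkage forces [k 1] to vanish, and [y] is again in the group with shifted
    exponents. *)
Lemma is_phi_inj k x : is_phi k x -> inG x -> forall n, k n = false.
Proof.
move=> kx Gx n; elim: n {-2}n (leqnn n) k x kx Gx => [|n IHn] m mn k x kx Gx.
  move: mn; rewrite leqn0 => /eqP ->; rewrite -(is_phi_k0 kx) /k0.
  by have [-> ->] := (inG_N0P Gx).1 (is_phi_N0 kx).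
have kk : k 0 = false.
  by rewrite -(is_phi_k0 kx) /k0; have [-> ->] := (inG_N0P Gx).1 (is_phi_N0 kx).
have [y ky xE] := is_phi_kshift kk kx.
have xE' : x = pair_aut y ((if k 1%N then genz else 1) * y).
  by rewrite xE; case: (k 1%N); rewrite ?pairM !mul1g.
move: (Gx); rewrite xE' => /inG_pairE[Gy _ /and3P[_ _ /eqP]].
have [y1 y2] := (inG_N0P Gy).1 (is_phi_N0 ky).
rewrite y1 addbF => kap.
have k1 : k 1%N = false.
  move: kap; case: (k 1%N) => //; rewrite kappaM ?inG_genz // kappa_genz sgn_genz addbF.
  by case: (kappa y).
case: m mn => [|[|m]] //; rewrite ltnS => mn.
exact: IHn m.+1 mn _ _ ky Gy.
Qed.

(** As [diag u * g] is in [N0], testing it on [b] and [c] gives [sgn 2 g = k0 u] and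
    [sgn 1 g = false]. The other two factors have trivial [k0]. *)
Lemma k0_section (b : bool) u g x : N0 x -> N0 u -> inG g ->
  x = (if b then genw1 else 1) * diag u * g -> k0 u = k0 x.
Proof.
move=> Nx Nu Gg xE; set w := if b then genw1 else 1 in xE.
have [Nw kw] : N0 w /\ k0 w = false.
  by rewrite /w; case: b {w xE}; split; rewrite ?k0_genw1 /k0 ?sgn1 //;
    [exact: N0_genw1|exact: N01].
have Ny : N0 (diag u * g).
  by rewrite -[X in N0 X](mulKg w) (mulgA w) -xE; apply: N0M (N0V Nw) Nx.
have Gb : inG (g * genb * g^-1) by apply: (inG_Nm Gg).1; exact: inG_genb.
have Gc : inG (g * genc * g^-1) by apply: (inG_Nm Gg).1; exact: inG_genc.
have kb := Ny.2 _ inG_genb; have kc := Ny.2 _ inG_genc.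
rewrite conjM kappa_diag_conj ?(Gb 0%N) // sgnJ kappaJ // in kb; last exact: inG_genb.
rewrite conjM kappa_diag_conj ?(Gc 0%N) // sgnJ kappaJ // in kc; last exact: inG_genc.
move: kb kc; rewrite !sgn_genb !sgn_genc kappa_genb kappa_genc /= !andbT !andbF !addbF.
rewrite xE !k0M kw k0_diag /k0; case_bits.
Qed.

Lemma is_phi_surj0 x : N0 x -> k0 x = false ->
  exists k y, [/\ k 0 = false, is_phi k y & eqG y x].
Proof.
move=> Nx kx.
have /choice[f fP] : forall x, exists p : bool * tree_aut, N0 x -> k0 x = false ->
    [/\ N0 p.2, k0 p.2 = false &
      exists g, [/\ inG g, N0 g & x = (if p.1 then genw1 else 1) * diag p.2 * g]].
  move=> {Nx kx}x; have [[Nx kx]|nx] := pselect (N0 x /\ k0 x = false); last first.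
    by exists (false, 1) => Nx kx; case: nx.
  have [k [u [g [Nu Gg xE]]]] := Nm_decomp (N0_Nm Nx).
  exists (k, u) => _ _ /=; have ku := k0_section Nx Nu Gg xE; rewrite kx in ku.
  split=> //; exists g; split=> //.
  have Nw : N0 ((if k then genw1 else 1) * diag u).
    by apply: N0M; [case: (k); [exact: N0_genw1|exact: N01]|exact: N0_diag].
  by rewrite -[g](mulKg ((if k then genw1 else 1) * diag u)) -xE; apply: N0M (N0V Nw) Nx.
pose y n := iter n (fun x => (f x).2) x.
have yP n : N0 (y n) /\ k0 (y n) = false.
  by elim: n => //= n [Nn kn]; have [] := fP _ Nn kn.
pose k n := if n is m.+1 then (f (y m)).1 else false.
(* Unfolding the decomposition [n] times: the iterated diagonal is trivial on level [n], so modulo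
   the group the products converge to [x]. *)
have xE n : exists2 g, inG g & x = wprod k n.+1 * iter n diag (y n) * g.
  elim: n => [|n [g Gg xE]].
    by exists 1; [exact: inG1|rewrite wprodS wprod0 !mulg1 mul1g].
  have [Nn kn] := yP n; have [_ _ [h [Gh Nh yE]]] := fP _ Nn kn.
  exists (iter n diag h * g); first by apply: inGM => //; case: (iter_diag_inG n Gh Nh).
  have kE : iter n diag (if k n.+1 then genw1 else 1) = if k n.+1 then wseq n.+1 else 1.
    by case: (k n.+1) => //; elim: (n) => //= m ->; exact: pair1.
  by rewrite xE {1}yE !iter_diagM -iterSr (wprodS k n.+1) -kE !mulgA.
have [z kz] := is_phi_exists k; exists k, z; split=> //.
apply: inG_closed => n; have [g Gg ->] := xE n; exists g => //.
rewrite -{1}[g]mul1g mulgA; apply: levelM => //.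
rewrite -(mulVg (wprod k n.+1)); apply: levelM.
  by apply: levelV; apply: (@level_nbhdW n n.+1) => //; exact: kz.
rewrite -{1}[wprod k n.+1]mulg1; apply: levelM => //.
by have := @level_iter_diag n 0 (y n) (level0 1 (y n)); rewrite addn0.
Qed.

Lemma is_phi_surj x : Nm x -> exists k y, is_phi k y /\ eqG y x.
Proof.
move=> Nx; have [h Gh Nxh] := Nm_adjust Nx.
suff [k [y [ky yx]]] : exists k y, is_phi k y /\ eqG y (x * h).
  exists k, y; split=> //; apply: eqG_trans yx _.
  exact/eqG_sym/eqG_mulr.
case kx : (k0 (x * h)); last first.
  by have [k [y [_ ky yx]]] := is_phi_surj0 Nxh kx; exists k, y.
(* Dividing by [w_0] reduces to the case of vanishing [k0]; the exponent at 0 is then reset to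
   [true]. *)
pose x' := genw0^-1 * (x * h).
have Nx' : N0 x' by apply: N0M Nxh; exact: N0V N0_genw0.
have [|k [y [kk ky yx]]] := is_phi_surj0 Nx'; first by rewrite k0M k0V k0_genw0 kx.
pose k' i := if i is 0 then true else k i.
have kE n : wprod k' n.+1 = genw0 * wprod k n.+1.
  elim: n => [|n IHn]; first by rewrite !wprodS !wprod0 kk !mul1g /= mulg1.
  by rewrite wprodS IHn (wprodS k n.+1) mulgA.
exists k', (genw0 * y); split; last by rewrite /eqG invgM -mulgA.
case=> [|n]; first exact: level0.
by rewrite kE; apply: levelM.
Qed.

(** * Topological limits, cosets, and the final isomorphism *)

Lemma tree_aut_hausdorff : hausdorff_space tree_aut.
Proof.
move=> u v uv; apply: tree_autP => t.
have [|//|x [ux vx]] := uv (level_nbhd (size t) u) (level_nbhd (size t) v).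
- by exists (size t).
- by exists (size t).
by rewrite -ux // vx.
Qed.

Lemma is_phi_cvg (k : nat -> bool) x : is_phi k x -> wprod k @ \oo --> x.
Proof.
move=> kx A [n nA]; exists n => // m nm; apply: nA.
by apply: level_trans (level_wprod k nm); apply: level_sym; exact: kx.
Qed.

Lemma normalizerP x :
  normalizer (closed_subgroup [set gena; genb; genc]) x <-> Nm x.
Proof.
split=> [nx|[N1 N2]]; first split=> g.
- by rewrite -closed_subgroupE; exact: normalizerJ.
- by rewrite -closed_subgroupE; exact: normalizerJV.
apply/seteqP; rewrite closed_subgroupE; split=> [_ [g Gg <-]|g Gg]; first exact: N1.
by exists (x^-1 * g * x); [exact: N2|rewrite !mulgA mulgV mul1g mulgK].
Qed.

Lemma left_cosetP (G : subgroup tree_aut) x y :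
  left_coset x G = left_coset y G <-> (G : set tree_aut) (x^-1 * y).
Proof.
have [G1 GM GV] := subgroupP G.
have sub u v : (G : set tree_aut) (u^-1 * v) -> left_coset v G `<=` left_coset u G.
  move=> Guv _ [g Gg <-]; exists (u^-1 * v * g); first exact: GM.
  by rewrite -!mulgA mulVKg.
split=> [xy|Gxy].
  have : left_coset y G y by exists 1; rewrite ?mulg1.
  by rewrite -xy => -[g Gg <-]; rewrite mulKg.
by apply/seteqP; split; apply: sub => //; have := GV _ Gxy; rewrite invgM invgK.
Qed.

Lemma left_cosetM (G : subgroup tree_aut) x y : normalizer G y ->
  [set a * b | a in left_coset x G & b in left_coset y G] = left_coset (x * y) G.
Proof.
move=> ny; have [G1 GM _] := subgroupP G; apply/seteqP; split.
  move=> _ [_ [g Gg <-]] [_ [h Gh <-]] <-; exists (y^-1 * g * y * h).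
    by apply: GM => //; exact: normalizerJV.
  by rewrite !mulgA mulgK.
move=> _ [g Gg <-]; exists x; first by exists 1 => //; rewrite mulg1.
by exists (y * g); [exists g|rewrite mulgA].
Qed.

Definition bits (k : nat -> 'F_2) : nat -> bool := fun i => k i != 0%R.

Lemma bits_inj : injective bits.
Proof.
move=> k l kl; apply/funext => i; have := congr1 (@^~ i) kl; rewrite /bits.
by case: (k i) (l i) => -[|[|//]] /= ? [[|[|//]] /= ?] // _; exact: val_inj.
Qed.

Lemma bitsD (k l : nat -> 'F_2) : bits (k + l)%R = (fun i => bits k i (+) bits l i).
Proof.
apply/funext => i; rewrite /bits /=.
change ((k + l)%R i) with (k i + l i)%R.
by case: (k i) (l i) => -[|[|//]] /= ? [[|[|//]] /= ?].
Qed.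

Lemma bits_surj (b : nat -> bool) : bits (fun i => (b i)%:R%R) = b.
Proof. by apply/funext => i; rewrite /bits; case: (b i). Qed.

Theorem theorem3p8p27 (a1 a2 a3 : tree_aut) (w : nat -> tree_aut)
  (a1E : a1 = sigma)
  (a2E : a2 = pair_aut a1 1)
  (a3E : a3 = pair_aut a2 a3)
  (w0E : w 0%N = pair_aut (a2 * w 0%N) (a3 * w 0%N))
  (w1E : w 1%N = pair_aut 1 ((a2 * a3) ^+ 2))
  (wSE : forall i : nat, (1 <= i)%N -> w i.+1 = pair_aut (w i) (w i)) :
  let G : subgroup tree_aut := closed_subgroup [set a1; a2; a3] in
  let N : set tree_aut := normalizer G in
  let phi (k : nat -> 'F_2) : tree_aut := lim (phi_prod w k @ \oo) in
  [/\ forall i : nat, N (w i),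
      w @ \oo --> (1 : tree_aut),
      forall k : nat -> 'F_2, cvg (phi_prod w k @ \oo) /\ N (phi k) &
      exists phibar : (nat -> 'F_2) -> quotient_group G,
        [/\ forall k : nat -> 'F_2,
              (phibar k : set tree_aut) = left_coset (phi k) G,
            forall k l : nat -> 'F_2,
              phibar (k + l)%R = phibar k * phibar l &
            bijective phibar]].
Proof.
have a1g : a1 = gena by [].
have a2g : a2 = genb by rewrite a2E a1g.
have a3g : a3 = genc.
  have [x [_ xU]] := a3_unique a2.
  by rewrite -(xU _ a3E); apply: xU; rewrite a2g; exact: gencE.
have wg : w = wseq.
  apply/funext; case=> [|n].
    have [x [_ xU]] := w0_unique a2 a3.
    rewrite -(xU _ w0E); apply: xU; rewrite a2g a3g {1}[wseq 0]genw0E.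
    by rewrite {1}gencE pairM.
  elim: n => [|n IHn]; first by rewrite w1E a2g a3g genzE.
  by rewrite wSE // IHn.
rewrite {}a1g {}a2g {}a3g {}wg => {a1 a2 a3 w a1E a2E a3E w0E w1E wSE} G N phi.
have phiP k : is_phi (bits k) (phi k) /\ phi_prod wseq k @ \oo --> phi k.
  have [x kx] := is_phi_exists (bits k).
  have kE : phi_prod wseq k = wprod (bits k).
    apply/funext => n; apply: eq_bigr => i _; rewrite /bits.
    by case: (_ == _).
  have cx : phi_prod wseq k @ \oo --> x by rewrite kE; exact: is_phi_cvg.
  by rewrite /phi (cvg_lim tree_aut_hausdorff cx).
have Nphi k : N (phi k).
  by apply/normalizerP/N0_Nm/(is_phi_N0 (phiP k).1).
have GE : G = inG :> set tree_aut by exact: closed_subgroupE.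
split.
- by move=> i; apply/normalizerP/N0_Nm; case: (N0_wseq i).
- move=> A [n nA]; exists n => // m nm; apply: nA.
  by apply: (level_nbhdW nm); exact: level_wseq.
- by move=> k; split=> //; apply/cvg_ex; exists (phi k); case: (phiP k).
have qP k : exists2 x, normalizer G x & left_coset (phi k) G = left_coset x G.
  by exists (phi k) => //; exact: Nphi.
(* Modulo the group, [phi] is additive with values of exponent two. Equal cosets therefore put
   [phi (k + l)] in the group, and all exponents of [k + l] vanish. *)
have phibar_eq k l : inG ((phi k)^-1 * phi l) -> k = l.
  move=> Gkl; have [[kx _] [ly _] [kly _]] := And3 (phiP k) (phiP l) (phiP (k + l)%R).
  have Nk := is_phi_N0 kx; apply: bits_inj; apply/funext => i.
  have eqkl : eqG (phi (k + l)%R) (phi k * phi l).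
    by apply: (is_phi_addb kx ly); rewrite -bitsD.
  have Gphi : inG (phi (k + l)%R).
    have := inGM (inG_sqr Nk) Gkl; rewrite -mulgA mulVKg => /inGM/(_ (inGV eqkl)).
    by rewrite invgM mulVKg invgK.
  have := is_phi_inj kly Gphi i; rewrite bitsD.
  by case: (bits k i); case: (bits l i).
exists (fun k => Defs.Quotient (qP k)); split=> //.
- move=> k l; apply: quotient_inj.
  transitivity (left_coset (phi k * phi l) G); last by apply/esym/left_cosetM/Nphi.
  apply/left_cosetP; rewrite GE.
  have [[kx _] [ly _] [kly _]] := And3 (phiP k) (phiP l) (phiP (k + l)%R).
  by apply: (is_phi_addb kx ly); rewrite -bitsD.
- have inj : injective (fun k => Defs.Quotient (qP k)).
    move=> k l /(congr1 (@quotient_set _ G)) /left_cosetP; rewrite GE.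
    exact: phibar_eq.
  have /choice[f fK] : forall A : quotient_group G, exists k, Defs.Quotient (qP k) = A.
    case=> A [x Nx AE]; have /normalizerP/is_phi_surj[b [y [yb yx]]] := Nx.
    exists (fun i => (b i)%:R%R); apply: quotient_inj; apply: etrans (esym AE).
    apply/left_cosetP; rewrite GE; apply: eqG_trans yx.
    set k := fun i => _; have [kx _] := phiP k; rewrite bits_surj in kx.
    have -> : phi k = y by apply: tree_autP => t; rewrite (kx (size t)) // (yb (size t)).
    exact: eqG_refl.
  by exists f => [k|A]; [apply: inj; exact: fK|exact: fK].
Qed.
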